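(* Let $(\Omega,\mathcal{F},P)$ be a probability space and $d$ a positive integer. Let $G$ be a nonempty, $\sigma$-stable, a.s. bounded, $\mathcal{T}_{c}$-closed and $L^0$-convex subset of $L^0(\mathcal{F},\mathbb{R}^d)$ and let $f:G\rightarrow G$ be a $\sigma$-stable $\mathcal{T}_{c}$-continuous mapping. Then $f$ has a fixed point, i.e. there is $x\in G$ with $f(x)=x$.
   Context: $L^0(\mathcal{F},\mathbb{R}^d)$ is the set of equivalence classes (modulo a.s. equality) of random vectors from $(\Omega,\mathcal{F},P)$ to $\mathbb{R}^d$; it is a module over the algebra $L^0(\mathcal{F})$ of equivalence classes of real random variables. The order on $L^0(\mathcal{F})$ is the a.s. order: $\xi\le\eta$ iff $\xi\le\eta$ a.s.; ''$\xi<\eta$ on $\Omega$'' means $\xi<\eta$ a.s. $L^0_+(\mathcal{F})=\{\xi\in L^0(\mathcal{F}):\xi\ge 0\}$ and $L^0_{++}(\mathcal{F})=\{\xi\in L^0(\mathcal{F}):\xi>0 \text{ on }\Omega\}$. The $L^0$-norm is $\|x\|=\sqrt{\sum_{i=1}^d x_i^2}\in L^0_+(\mathcal{F})$ for $x=(x_1,\dots,x_d)$. $\tilde I_A$ is the equivalence class of the indicator function of $A\in\mathcal{F}$. $\mathcal{T}_c$ is the topology on $L^0(\mathcal{F},\mathbb{R}^d)$ having as a base the random open balls $B(x,r)=\{y:\|x-y\|<r\text{ on }\Omega\}$, $x\in L^0(\mathcal{F},\mathbb{R}^d)$, $r\in L^0_{++}(\mathcal{F})$. A subset $G$ is: a.s.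 bounded if the supremum $\bigvee\{\|x\|:x\in G\}$ (in the complete lattice of equivalence classes of extended real random variables) belongs to $L^0_+(\mathcal{F})$; $L^0$-convex if $\lambda x+(1-\lambda)y\in G$ for all $x,y\in G$ and $\lambda\in L^0_+(\mathcal{F})$ with $\lambda\le 1$; $\sigma$-stable if $\sum_{n=1}^\infty \tilde I_{A_n}x_n\in G$ for every sequence $\{x_n\}$ in $G$ and every countable measurable partition $\{A_n\}$ of $\Omega$ (the sum is the class of the function equal to a representative of $x_n$ on $A_n$). A mapping $f:G\to G$ is $\sigma$-stable if $G$ is $\sigma$-stable and $f(\sum_n\tilde I_{A_n}x_n)=\sum_n\tilde I_{A_n}f(x_n)$ for all such sequences and partitions; it is $\mathcal{T}_c$-continuous if it is continuous from $(G,\mathcal{T}_c)$ to $(G,\mathcal{T}_c)$. *)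

(* Defs.v *)
From HB Require Import structures.
From mathcomp Require Import all_boot all_order all_algebra generic_quotient.
From mathcomp Require Import all_classical all_reals all_analysis.
From mathcomp Require Import measurable_realfun.
From mathcomp Require Import ring lra.

Set Implicit Arguments.
Unset Strict Implicit.
Unset Printing Implicit Defensive.

Import Order.TTheory GRing.Theory Num.Theory.
Import numFieldNormedType.Exports.

Local Open Scope classical_set_scope.
Local Open Scope ring_scope.

Lemma ae_mp d (T : measurableType d) (R : realType)
    (mu : {measure set T -> \bar R}) (A B : T -> Prop) :
  {ae mu, forall w, A w} -> {ae mu, forall w, A w -> B w} ->
  {ae mu, forall w, B w}.
Proof. by move=> hA hAB; apply: filterS2 hA hAB => w a; apply. Qed.

Section ae_class.
Context d1 d2 (T1 : measurableType d1) (T2 : measurableType d2) (R : realType).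
Variable mu : {measure set T1 -> \bar R}.

Definition ae_class (f : T1 -> T2) (mf : measurable_fun setT f) :
    {mfun_ mu, T1 >-> T2} :=
  (\pi_({mfun_ mu, T1 >-> T2}) (mfun_Sub (mem_set mf)))%qT.

Lemma ae_classE (f : T1 -> T2) (mf : measurable_fun setT f) :
  {ae mu, forall w, ae_class mf w = f w}.
Proof.
have /eqmodP/asboolP : (\pi_({mfun_ mu, T1 >-> T2}) (repr (ae_class mf)) =
    \pi_({mfun_ mu, T1 >-> T2}) (mfun_Sub (mem_set mf)))%qT by rewrite reprK.
by apply: filterS => w /(_ I).
Qed.

Lemma ae_class_eqP (x y : {mfun_ mu, T1 >-> T2}) :
  {ae mu, forall w, x w = y w} <-> x = y.
Proof.
split=> [xy|->]; last exact: nearW.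
rewrite -[x]reprK -[y]reprK; apply/eqP; rewrite eqmodE.
by apply/asboolP; apply: filterS xy => w.
Qed.

Lemma measurable_repr (x : {mfun_ mu, T1 >-> T2}) : measurable_fun setT x.
Proof. exact: measurable_funPT. Qed.

End ae_class.

Section L0.
Context disp (Omega : measurableType disp) (R : realType).

Definition L0 (P : probability Omega R) : Type := {mfun_ P, Omega >-> R}.

Identity Coercion L0_aeEqMfun : L0 >-> aeEqMfun.

Variable P : probability Omega R.
Implicit Types x y z : L0 P.

HB.instance Definition _ := Choice.on (L0 P).

Let measurableD_repr x y : measurable_fun setT (fun w => x w + y w).
Proof. by apply: measurable_funD; exact: measurable_repr. Qed.

Let measurableN_repr x : measurable_fun setT (fun w => - x w).
Proof. by apply: measurableT_comp => //; exact: measurable_repr. Qed.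

Let measurableM_repr x y : measurable_fun setT (fun w => x w * y w).
Proof. by apply: measurable_funM; exact: measurable_repr. Qed.

Definition L0_cst (r : R) : L0 P := ae_class P (measurable_cst r).
Definition L0_add x y : L0 P := ae_class P (measurableD_repr x y).
Definition L0_opp x : L0 P := ae_class P (measurableN_repr x).
Definition L0_mul x y : L0 P := ae_class P (measurableM_repr x y).

Let cstE r : {ae P, forall w, L0_cst r w = r}. Proof. exact: ae_classE. Qed.
Let addE x y : {ae P, forall w, L0_add x y w = x w + y w}.
Proof. exact: ae_classE. Qed.
Let oppE x : {ae P, forall w, L0_opp x w = - x w}. Proof. exact: ae_classE. Qed.
Let mulE x y : {ae P, forall w, L0_mul x y w = x w * y w}.
Proof. exact: ae_classE. Qed.

Let addA : associative L0_add.
Proof.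
move=> x y z; apply/ae_class_eqP.
by apply: (ae_mp (addE x y));
  apply: (ae_mp (addE (L0_add x y) z));
  apply: (ae_mp (addE y z));
  apply: (ae_mp (addE x (L0_add y z)));
  apply: nearW => w -> -> -> ->; rewrite addrA.
Qed.

Let addC : commutative L0_add.
Proof.
move=> x y; apply/ae_class_eqP.
by apply: (ae_mp (addE y x));
  apply: (ae_mp (addE x y));
  apply: nearW => w -> ->; rewrite addrC.
Qed.

Let add0 : left_id (L0_cst 0) L0_add.
Proof.
move=> x; apply/ae_class_eqP.
by apply: (ae_mp (cstE 0));
  apply: (ae_mp (addE (L0_cst 0) x));
  apply: nearW => w -> ->; rewrite add0r.
Qed.

Let addN : left_inverse (L0_cst 0) L0_opp L0_add.
Proof.
move=> x; apply/ae_class_eqP.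
by apply: (ae_mp (cstE 0));
  apply: (ae_mp (oppE x));
  apply: (ae_mp (addE (L0_opp x) x));
  apply: nearW => w -> -> ->;
  rewrite addNr.
Qed.

HB.instance Definition _ := GRing.isZmodule.Build (L0 P) addA addC add0 addN.

Let mulA : associative L0_mul.
Proof.
move=> x y z; apply/ae_class_eqP.
by apply: (ae_mp (mulE x y));
  apply: (ae_mp (mulE (L0_mul x y) z));
  apply: (ae_mp (mulE y z));
  apply: (ae_mp (mulE x (L0_mul y z)));
  apply: nearW => w -> -> -> ->; rewrite mulrA.
Qed.

Let mulC : commutative L0_mul.
Proof.
move=> x y; apply/ae_class_eqP.
by apply: (ae_mp (mulE y x));
  apply: (ae_mp (mulE x y));
  apply: nearW => w -> ->; rewrite mulrC.
Qed.

Let mul1 : left_id (L0_cst 1) L0_mul.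
Proof.
move=> x; apply/ae_class_eqP.
by apply: (ae_mp (cstE 1));
  apply: (ae_mp (mulE (L0_cst 1) x));
  apply: nearW => w -> ->; rewrite mul1r.
Qed.

Let mulD : left_distributive L0_mul (@GRing.add (L0 P)).
Proof.
move=> x y z; apply/ae_class_eqP.
by apply: (ae_mp (addE (L0_mul x z) (L0_mul y z)));
  apply: (ae_mp (mulE y z));
  apply: (ae_mp (mulE x z));
  apply: (ae_mp (addE x y));
  apply: (ae_mp (mulE (L0_add x y) z));
  apply: nearW => w -> -> xz yz ->;
  rewrite xz yz mulrDl.
Qed.

Let oner_neq0 : L0_cst 1 != 0.
Proof.
apply/eqP => /ae_class_eqP h.
have : \forall w \ae P, False.
  apply: (ae_mp (cstE 0));
  apply: (ae_mp (cstE 1));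
  apply: (ae_mp h);
  apply: nearW => w + e1 e0.
  by rewrite e1 e0 => /eqP; rewrite oner_eq0.
case=> N [_ PN0 sN]; have NT : N = setT.
  by apply/seteqP; split=> // w _; apply: sN.
by have := probability_setT P; rewrite -NT PN0 => /esym/eqP; rewrite onee_eq0.
Qed.

HB.instance Definition _ :=
  GRing.Zmodule_isComNzRing.Build (L0 P) mulA mulC mul1 mulD oner_neq0.

Definition L0_le x y : bool := `[< {ae P, forall w, x w <= y w} >].

Let le_refl : reflexive L0_le.
Proof. by move=> x; apply/asboolP; exact: nearW. Qed.

Let le_anti : antisymmetric L0_le.
Proof.
move=> x y /andP[/asboolP xy /asboolP yx]; apply/ae_class_eqP.
by apply: (ae_mp (yx));
  apply: (ae_mp (xy));
  apply: nearW => w h1 h2; apply/eqP; rewrite eq_le h1.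
Qed.

Let le_trans : transitive L0_le.
Proof.
move=> y x z /asboolP xy /asboolP yz; apply/asboolP.
by apply: (ae_mp (yz));
  apply: (ae_mp (xy));
  apply: nearW => w; exact: le_trans.
Qed.

HB.instance Definition _ :=
  Order.Le_isPOrder.Build ring_display (L0 P) le_refl le_anti le_trans.

(* Not the strict part of [<=] (which only means [x <= y] and [x != y]). *)
Definition L0_lt x y := {ae P, forall w, x w < y w}.

Lemma L0_leP x y : x <= y <-> {ae P, forall w, x w <= y w}.
Proof. by split=> [/asboolP|h]; [|apply/asboolP]. Qed.

Lemma L0_0E : {ae P, forall w, (0 : L0 P) w = 0}. Proof. exact: cstE. Qed.
Lemma L0_1E : {ae P, forall w, (1 : L0 P) w = 1}. Proof. exact: cstE. Qed.
Lemma L0_DE x y : {ae P, forall w, (x + y : L0 P) w = x w + y w}.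
Proof. exact: addE. Qed.
Lemma L0_NE x : {ae P, forall w, (- x : L0 P) w = - x w}.
Proof. exact: oppE. Qed.
Lemma L0_ME x y : {ae P, forall w, (x * y : L0 P) w = x w * y w}.
Proof. exact: mulE. Qed.

End L0.

Section L0bar.
Context disp (Omega : measurableType disp) (R : realType).

Definition L0bar (P : probability Omega R) : Type :=
  {mfun_ P, Omega >-> \bar R}.

Identity Coercion L0bar_aeEqMfun : L0bar >-> aeEqMfun.

Variable P : probability Omega R.
Implicit Types x y z : L0bar P.

HB.instance Definition _ := Choice.on (L0bar P).

Definition L0bar_le x y : bool := `[< {ae P, forall w, (x w <= y w)%E} >].

Let le_refl : reflexive L0bar_le.
Proof. by move=> x; apply/asboolP; exact: nearW. Qed.

Let le_anti : antisymmetric L0bar_le.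
Proof.
move=> x y /andP[/asboolP xy /asboolP yx]; apply/ae_class_eqP.
by apply: (ae_mp (yx));
  apply: (ae_mp (xy));
  apply: nearW => w h1 h2; apply/eqP; rewrite eq_le h1.
Qed.

Let le_trans : transitive L0bar_le.
Proof.
move=> y x z /asboolP xy /asboolP yz; apply/asboolP.
by apply: (ae_mp (yz));
  apply: (ae_mp (xy));
  apply: nearW => w; exact: le_trans.
Qed.

HB.instance Definition _ :=
  Order.Le_isPOrder.Build ereal_display (L0bar P) le_refl le_anti le_trans.

Lemma L0bar_leP x y : (x <= y)%O <-> {ae P, forall w, (x w <= y w)%E}.
Proof. by split=> [/asboolP|h]; [|apply/asboolP]. Qed.

Let measurable_EFin_repr (x : L0 P) : measurable_fun setT (EFin \o x).
Proof. by apply/measurable_EFinP; exact: measurable_repr. Qed.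

Definition L0_EFin (x : L0 P) : L0bar P :=
  ae_class P (measurable_EFin_repr x).

Lemma L0_EFinE (x : L0 P) : {ae P, forall w, L0_EFin x w = (x w)%:E}.
Proof. exact: ae_classE. Qed.

End L0bar.

Section L0vec.
Context disp (Omega : measurableType disp) (R : realType).

(* The product sigma-algebra on [d.-tuple R] is the Borel one of R^d. *)
Definition L0vec (P : probability Omega R) (d : nat) : Type :=
  {mfun_ P, Omega >-> d.-tuple R}.

Identity Coercion L0vec_aeEqMfun : L0vec >-> aeEqMfun.

Variables (P : probability Omega R) (d : nat).
Implicit Types x y z : L0vec P d.

HB.instance Definition _ := Choice.on (L0vec P d).

Lemma measurable_mktuple (h : 'I_d -> Omega -> R) :
  (forall i, measurable_fun setT (h i)) ->
  measurable_fun setT (fun w => [tuple h i w | i < d]).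
Proof.
move=> mh; apply/measurable_fun_tnthP => i.
by rewrite (_ : _ \o _ = h i)//; apply/funext => w; rewrite /= tnth_mktuple.
Qed.

Lemma measurable_tnth_repr x i : measurable_fun setT (fun w => tnth (x w) i).
Proof.
exact: (measurable_fun_tnthP (x : Omega -> _)).1 (measurable_repr x) i.
Qed.

Let measurable0_repr : measurable_fun setT
  (fun w : Omega => [tuple (0 : R) | i < d]).
Proof. exact: measurable_cst. Qed.

Let measurableD_repr x y :
  measurable_fun setT (fun w => [tuple tnth (x w) i + tnth (y w) i | i < d]).
Proof.
by apply: measurable_mktuple => i; apply: measurable_funD;
  exact: measurable_tnth_repr.
Qed.

Let measurableN_repr x :
  measurable_fun setT (fun w => [tuple - tnth (x w) i | i < d]).
Proof.
apply: measurable_mktuple => i; apply: measurableT_comp => //.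
exact: measurable_tnth_repr.
Qed.

Let measurableZ_repr (a : L0 P) x :
  measurable_fun setT (fun w => [tuple a w * tnth (x w) i | i < d]).
Proof.
apply: measurable_mktuple => i; apply: measurable_funM.
  exact: measurable_repr.
exact: measurable_tnth_repr.
Qed.

Definition L0vec_zero : L0vec P d := ae_class P measurable0_repr.
Definition L0vec_add x y : L0vec P d := ae_class P (measurableD_repr x y).
Definition L0vec_opp x : L0vec P d := ae_class P (measurableN_repr x).
Definition L0vec_scale (a : L0 P) x : L0vec P d :=
  ae_class P (measurableZ_repr a x).

Let eqP_ x y :
  {ae P, forall w, forall i, tnth (x w) i = tnth (y w) i} -> x = y.
Proof.
move=> h; apply/ae_class_eqP.
by apply: filterS h => w; exact: eq_from_tnth.
Qed.

Let zeroE : {ae P, forall w, forall i, tnth (L0vec_zero w) i = 0}.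
Proof.
by apply: filterS (ae_classE P measurable0_repr) => w /= + i;
  rewrite /L0vec_zero => ->; rewrite tnth_mktuple.
Qed.

Let addE x y : {ae P, forall w, forall i,
  tnth (L0vec_add x y w) i = tnth (x w) i + tnth (y w) i}.
Proof.
by apply: filterS (ae_classE P (measurableD_repr x y)) => w /= + i;
  rewrite /L0vec_add => ->; rewrite tnth_mktuple.
Qed.

Let oppE x : {ae P, forall w, forall i,
  tnth (L0vec_opp x w) i = - tnth (x w) i}.
Proof.
by apply: filterS (ae_classE P (measurableN_repr x)) => w /= + i;
  rewrite /L0vec_opp => ->; rewrite tnth_mktuple.
Qed.

Let scaleE (a : L0 P) x : {ae P, forall w, forall i,
  tnth (L0vec_scale a x w) i = a w * tnth (x w) i}.
Proof.
by apply: filterS (ae_classE P (measurableZ_repr a x)) => w /= + i;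
  rewrite /L0vec_scale => ->; rewrite tnth_mktuple.
Qed.

Let addA : associative L0vec_add.
Proof.
move=> x y z; apply: eqP_.
by apply: (ae_mp (addE x y));
  apply: (ae_mp (addE (L0vec_add x y) z));
  apply: (ae_mp (addE y z));
  apply: (ae_mp (addE x (L0vec_add y z)));
  apply: nearW => w e1 e2 e3 e4 i; rewrite e1 e2 e3 e4 addrA.
Qed.

Let addC : commutative L0vec_add.
Proof.
move=> x y; apply: eqP_.
by apply: (ae_mp (addE y x));
  apply: (ae_mp (addE x y));
  apply: nearW => w e1 e2 i; rewrite e1 e2 addrC.
Qed.

Let add0 : left_id L0vec_zero L0vec_add.
Proof.
move=> x; apply: eqP_.
by apply: (ae_mp (zeroE));
  apply: (ae_mp (addE L0vec_zero x));
  apply: nearW => w e1 e2 i;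
  rewrite e1 e2 add0r.
Qed.

Let addN : left_inverse L0vec_zero L0vec_opp L0vec_add.
Proof.
move=> x; apply: eqP_.
by apply: (ae_mp (zeroE));
  apply: (ae_mp (oppE x));
  apply: (ae_mp (addE (L0vec_opp x) x));
  apply: nearW => w e1 e2 e3 i;
  rewrite e1 e2 e3 addNr.
Qed.

HB.instance Definition _ :=
  GRing.isZmodule.Build (L0vec P d) addA addC add0 addN.

Let scaleA (a b : L0 P) x :
  L0vec_scale a (L0vec_scale b x) = L0vec_scale (a * b) x.
Proof.
apply: eqP_.
by apply: (ae_mp (L0_ME a b));
  apply: (ae_mp (scaleE (a * b) x));
  apply: (ae_mp (scaleE b x));
  apply: (ae_mp (scaleE a (L0vec_scale b x)));
  apply: nearW => w e1 e2 e3 e4 i; rewrite e1 e2 e3 e4 mulrA.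
Qed.

Let scale1 : left_id (1 : L0 P) L0vec_scale.
Proof.
move=> x; apply: eqP_.
by apply: (ae_mp (L0_1E P));
  apply: (ae_mp (scaleE 1 x));
  apply: nearW => w e1 e2 i; rewrite e1 e2 mul1r.
Qed.

Let scaleDr : right_distributive L0vec_scale +%R.
Proof.
move=> a x y; apply: eqP_.
by apply: (ae_mp (addE (L0vec_scale a x) (L0vec_scale a y)));
  apply: (ae_mp (scaleE a y));
  apply: (ae_mp (scaleE a x));
  apply: (ae_mp (addE x y));
  apply: (ae_mp (scaleE a (x + y)));
  apply: nearW => w e1 e2 e3 e4 e5 i;
  rewrite e1 e2 e5 e3 e4 mulrDr.
Qed.

Let scaleDl x : {morph L0vec_scale^~ x : a b / a + b >-> a + b}.
Proof.
move=> a b; apply: eqP_.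
by apply: (ae_mp (addE (L0vec_scale a x) (L0vec_scale b x)));
  apply: (ae_mp (scaleE b x));
  apply: (ae_mp (scaleE a x));
  apply: (ae_mp (L0_DE a b));
  apply: (ae_mp (scaleE (a + b) x));
  apply: nearW => w e1 e2 e3 e4 e5 i;
  rewrite e1 e2 e5 e3 e4 mulrDl.
Qed.

HB.instance Definition _ := GRing.Zmodule_isLmodule.Build (L0 P) (L0vec P d)
  scaleA scale1 scaleDr scaleDl.

Lemma L0vec_0E : {ae P, forall w, forall i, tnth ((0 : L0vec P d) w) i = 0}.
Proof. exact: zeroE. Qed.
Lemma L0vec_DE x y : {ae P, forall w, forall i,
  tnth ((x + y : L0vec P d) w) i = tnth (x w) i + tnth (y w) i}.
Proof. exact: addE. Qed.
Lemma L0vec_NE x : {ae P, forall w, forall i,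
  tnth ((- x : L0vec P d) w) i = - tnth (x w) i}.
Proof. exact: oppE. Qed.
Lemma L0vec_ZE (a : L0 P) x : {ae P, forall w, forall i,
  tnth ((a *: x : L0vec P d) w) i = a w * tnth (x w) i}.
Proof. exact: scaleE. Qed.

Definition euclid (v : d.-tuple R) : R :=
  Num.sqrt (\sum_(i < d) tnth v i ^+ 2).

Let measurable_norm_repr x : measurable_fun setT (fun w => euclid (x w)).
Proof.
apply: (measurableT_comp (continuous_measurable_fun (@sqrt_continuous R))).
apply: measurable_sum => i; apply: measurable_funX.
exact: measurable_tnth_repr.
Qed.

Definition L0norm x : L0 P := ae_class P (measurable_norm_repr x).

Lemma L0normE x : {ae P, forall w, L0norm x w = euclid (x w)}.
Proof. exact: ae_classE. Qed.

End L0vec.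

Section euclid_triangle.
Context (R : realType) (d : nat).
Implicit Types u v s : d.-tuple R.

Lemma euclid_ge0 u : 0 <= euclid u. Proof. exact: sqrtr_ge0. Qed.

Lemma sqr_euclid u : euclid u ^+ 2 = \sum_(i < d) tnth u i ^+ 2.
Proof. by rewrite sqr_sqrtr// sumr_ge0// => i _; exact: sqr_ge0. Qed.

Lemma euclid_eq0 u : euclid u = 0 -> forall i, tnth u i = 0.
Proof.
move=> u0 i; have /eqP := sqr_euclid u; rewrite u0 expr0n/= eq_sym.
rewrite psumr_eq0; last by move=> j _; exact: sqr_ge0.
by move=> /allP/(_ i (mem_index_enum i)); rewrite sqrf_eq0 => /eqP.
Qed.

Lemma euclid_dot u v :
  \sum_(i < d) tnth u i * tnth v i <= euclid u * euclid v.
Proof.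
set a := euclid u; set b := euclid v.
have a0 : 0 <= a := euclid_ge0 u; have b0 : 0 <= b := euclid_ge0 v.
have [ab0|] := eqVneq (a * b) 0.
  rewrite ab0 big1// => i _; move/eqP: ab0; rewrite mulf_eq0.
  by case/orP=> /eqP /euclid_eq0 ->; rewrite ?mul0r ?mulr0.
move=> abn0; have ab_gt0 : 0 < a * b by rewrite lt0r abn0 mulr_ge0.
have : 0 <= \sum_(i < d) (b * tnth u i - a * tnth v i) ^+ 2.
  by rewrite sumr_ge0// => i _; exact: sqr_ge0.
have -> : \sum_(i < d) (b * tnth u i - a * tnth v i) ^+ 2 =
    b ^+ 2 * a ^+ 2 - 2 * (a * b) * (\sum_(i < d) tnth u i * tnth v i)
    + a ^+ 2 * b ^+ 2.
  rewrite [in b ^+ 2 * _](sqr_euclid u) [in a ^+ 2 * b ^+ 2](sqr_euclid v).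
  rewrite !mulr_sumr -sumrB -big_split/=.
  by apply: eq_bigr => i _; ring.
move=> h; rewrite -(ler_pM2l ab_gt0); nra.
Qed.

Lemma euclid_triangle u v s :
  (forall i, tnth s i = tnth u i + tnth v i) -> euclid s <= euclid u + euclid v.
Proof.
move=> suv; rewrite -(@ler_pXn2r _ 2)// ?nnegrE ?addr_ge0 ?euclid_ge0//.
have -> : euclid s ^+ 2 =
    euclid u ^+ 2 + 2 * (\sum_(i < d) tnth u i * tnth v i) + euclid v ^+ 2.
  rewrite !sqr_euclid mulr_sumr -!big_split/=.
  by apply: eq_bigr => i _; rewrite suv; ring.
by have := euclid_dot u v; rewrite sqrrD; lra.
Qed.

End euclid_triangle.

Section Tc.
Context disp (Omega : measurableType disp) (R : realType).
Variables (P : probability Omega R) (d : nat).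
Implicit Types (x y z : L0vec P d) (r : L0 P).

Definition L0_ball x r : set (L0vec P d) := [set y | L0_lt (L0norm (x - y)) r].

Definition L0_pp : set (L0 P) := [set r | L0_lt 0 r].

Lemma L0norm_sub_triangle x y z : {ae P, forall w,
  L0norm (x - z) w <= L0norm (x - y) w + L0norm (y - z) w}.
Proof.
apply: (ae_mp (L0normE (x - z))); apply: (ae_mp (L0normE (x - y))).
apply: (ae_mp (L0normE (y - z))).
have e : x - z = (x - y) + (y - z) by rewrite addrA subrK.
apply: (ae_mp (L0vec_DE (x - y) (y - z))); rewrite -e; apply: nearW => w h.
by move=> -> -> ->; exact: euclid_triangle.
Qed.

Lemma L0norm0 : {ae P, forall w, L0norm (0 : L0vec P d) w = 0}.
Proof.
apply: (ae_mp (L0normE (0 : L0vec P d))); apply: (ae_mp (L0vec_0E P d)).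
apply: nearW => w h ->; rewrite /euclid big1 ?sqrtr0// => i _.
by rewrite h expr0n.
Qed.

Let measurable_min_repr r1 r2 :
  measurable_fun setT (fun w => Num.min (r1 w) (r2 w)).
Proof. by apply: measurable_minr; exact: measurable_repr. Qed.

Lemma L0_ball_center x r : L0_pp r -> L0_ball x r x.
Proof.
move=> r_gt0; rewrite /L0_ball /L0_lt /= subrr; apply: (ae_mp L0norm0).
apply: (ae_mp (L0_0E P)); apply: (ae_mp r_gt0).
by apply: nearW => w h e0 ->; rewrite -e0.
Qed.

Lemma L0_ballI x1 x2 r1 r2 y : L0_ball x1 r1 y -> L0_ball x2 r2 y ->
  exists2 r, L0_pp r & L0_ball y r `<=` L0_ball x1 r1 `&` L0_ball x2 r2.
Proof.
move=> y1 y2.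
pose s1 := r1 - L0norm (x1 - y); pose s2 := r2 - L0norm (x2 - y).
have sE x r : {ae P, forall w,
    (r - L0norm (x - y) : L0 P) w = r w - L0norm (x - y) w}.
  apply: (ae_mp (L0_DE r (- L0norm (x - y)))).
  by apply: (ae_mp (L0_NE (L0norm (x - y)))); apply: nearW => w -> ->.
pose m : L0 P := ae_class P (measurable_min_repr s1 s2).
have mE : {ae P, forall w, m w =
    Num.min (r1 w - L0norm (x1 - y) w) (r2 w - L0norm (x2 - y) w)}.
  apply: (ae_mp (ae_classE P (measurable_min_repr s1 s2))).
  apply: (ae_mp (sE x1 r1)); apply: (ae_mp (sE x2 r2)).
  by apply: nearW => w; rewrite /m /s1 /s2 => <- <- ->.
have m_gt0 : L0_pp m.
  apply: (ae_mp mE); apply: (ae_mp (L0_0E P)).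
  apply: (ae_mp y1); apply: (ae_mp y2); apply: nearW => w h2 h1 -> ->.
  by rewrite lt_min !subr_gt0 h1.
exists m => // z yz; split.
  apply: (ae_mp (L0norm_sub_triangle x1 y z)); apply: (ae_mp mE).
  apply: (ae_mp yz); apply: nearW => w h mw tri; apply: le_lt_trans tri _.
  by move: h; rewrite mw lt_min ltrBrDl => /andP[].
apply: (ae_mp (L0norm_sub_triangle x2 y z)); apply: (ae_mp mE).
apply: (ae_mp yz); apply: nearW => w h mw tri; apply: le_lt_trans tri _.
by move: h; rewrite mw lt_min => /andP[_]; rewrite ltrBrDl.
Qed.

Let ball_cover :
  \bigcup_(xr in [set xr : L0vec P d * L0 P | L0_pp xr.2]) L0_ball xr.1 xr.2
  = setT.
Proof.
apply/seteqP; split=> // x _; have r_gt0 : L0_pp 1.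
  apply: (ae_mp (L0_0E P)); apply: (ae_mp (L0_1E P)).
  by apply: nearW => w -> ->.
by exists (x, 1) => //; exact: L0_ball_center.
Qed.

Let ball_join (i j : L0vec P d * L0 P) y :
  L0_pp i.2 -> L0_pp j.2 -> L0_ball i.1 i.2 y -> L0_ball j.1 j.2 y ->
  exists k : L0vec P d * L0 P, [/\ L0_pp k.2, L0_ball k.1 k.2 y &
    L0_ball k.1 k.2 `<=` L0_ball i.1 i.2 `&` L0_ball j.1 j.2].
Proof.
move=> _ _ y1 y2; have [r r_gt0 yr] := L0_ballI y1 y2.
by exists (y, r); split=> //; exact: L0_ball_center.
Qed.

HB.instance Definition _ := isPointed.Build (L0 P) 0.
HB.instance Definition _ := isPointed.Build (L0vec P d) 0.
HB.instance Definition _ :=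
  isBaseTopological.Build (L0vec P d) ball_cover ball_join.

Lemma L0_openP (U : set (L0vec P d)) :
  open U <-> forall x, U x -> exists2 r, L0_pp r & L0_ball x r `<=` U.
Proof.
split=> [[D' D'pp <-] x [[y r] D'yr xyr]|Uball].
  have [s s_gt0 xs] := L0_ballI xyr xyr.
  by exists s => // z /xs[yz _]; exists (y, r).
exists [set xr : L0vec P d * L0 P | L0_pp xr.2 /\ L0_ball xr.1 xr.2 `<=` U].
  by move=> xr [].
apply/seteqP; split=> [x [xr [_ sub] xrx]|x /Uball[r r_gt0 sub]].
  exact: sub xrx.
by exists (x, r) => //; exact: L0_ball_center.
Qed.

End Tc.

Record countable_partition disp (Omega : measurableType disp) := {
  cpart :> nat -> set Omega;
  cpart_measurable : forall n, measurable (cpart n);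
  cpart_disjoint : trivIset setT cpart;
  cpart_cover : \bigcup_n cpart n = setT
}.

Section concatenation.
Context disp (Omega : measurableType disp) (R : realType).
Variables (P : probability Omega R) (d : nat).
Implicit Types (A : countable_partition Omega) (x : nat -> L0vec P d).

Definition cpart_index A (w : Omega) : nat := xget 0 [set n | A n w].

Lemma cpart_indexE A n w : A n w -> cpart_index A w = n.
Proof.
move=> Anw; have Aw : A (cpart_index A w) w.
  exact: (@xgetPex _ 0%N [set k | A k w] (ex_intro _ n Anw)).
by apply: (@cpart_disjoint _ _ A) => //; exists w.
Qed.

Let measurable_concat_repr A x :
  measurable_fun setT (fun w => x (cpart_index A w) w).
Proof.
move=> _ Y mY; rewrite setTI.
rewrite (_ : _ @^-1` Y = \bigcup_n (A n `&` (x n @^-1` Y))).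
  apply: bigcup_measurable => n _; apply: measurableI.
    exact: cpart_measurable.
  by rewrite -[X in measurable X]setTI; exact: measurable_repr.
apply/seteqP; split=> w /=.
  have : (\bigcup_n A n) w by rewrite cpart_cover.
  by case=> n _ Anw; rewrite (cpart_indexE Anw) => Yw; exists n.
by case=> n _ [Anw Yw]; rewrite /= (cpart_indexE Anw).
Qed.

(* $\sum_n \tilde I_{A_n} x_n$ *)
Definition concat A x : L0vec P d := ae_class P (measurable_concat_repr A x).

Lemma concatE A x n : {ae P, forall w, A n w -> concat A x w = x n w}.
Proof.
apply: (ae_mp (ae_classE P (measurable_concat_repr A x))).
by apply: nearW => w + Anw; rewrite /concat (cpart_indexE Anw).
Qed.

End concatenation.

Section notions.
Context disp (Omega : measurableType disp) (R : realType).
Variables (P : probability Omega R) (d : nat).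
Implicit Types G : set (L0vec P d).

(* The supremum is taken in the a.s. order on classes of functions to
   [\bar R], of which [L0_EFin] embeds the finite-valued ones. *)
Definition as_bounded G := exists2 xi : L0 P, 0 <= xi &
  supremums [set L0_EFin (L0norm x) | x in G] (L0_EFin xi).

Definition L0_convex G := forall x y (l : L0 P),
  G x -> G y -> 0 <= l -> l <= 1 -> G (l *: x + (1 - l) *: y).

Definition sigma_stable G :=
  forall (A : countable_partition Omega) (x : nat -> L0vec P d),
    (forall n, G (x n)) -> G (concat A x).

Definition sigma_stable_map G (f : L0vec P d -> L0vec P d) :=
  sigma_stable G /\
  forall (A : countable_partition Omega) (x : nat -> L0vec P d),
    (forall n, G (x n)) -> f (concat A x) = concat A (f \o x).

End notions.

(* Main.v *)
Require Import Defs.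
From mathcomp Require Import all_boot all_order all_algebra.
From mathcomp Require Import all_classical all_reals all_analysis.
From mathcomp Require Import measurable_realfun ring lra zify.

(* The nearest-point projection of [L0vec] onto [G] exists: by [sigma_stable]
   and closedness one can maximise the expectation of a decreasing function of
   the distance, and a maximiser is nearest almost surely. It is nonexpansive,
   so composing it with [f] leaves a local continuous map [g] of the whole
   module into a bounded set, and a fixed point of [g] is one of [f].
   For each sample point, Scarf's lemma applied to the values of [g] on a finite
   grid of a simplex yields finitely many grid points, close to each other, such
   that for each of the [d + 1] coordinates one of them has this coordinate
   (almost) increased by [g]. These points are chosen measurably, and a random
   subsequence converges almost surely. Convergence in the topology T_c is not
   needed: given the random radius provided by the continuity of [g] at the
   limit, a random index brings the points within this radius, and locality
   identifies the values of [g] at the randomly chosen grid points. Hence [g]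
   decreases no coordinate of the limit; as coordinates sum to a constant, the
   limit is fixed. *)

Set Implicit Arguments.
Unset Strict Implicit.
Unset Printing Implicit Defensive.

Import Order.TTheory GRing.Theory Num.Theory.
Import numFieldNormedType.Exports.

(** * Scarf's lemma *)

(* The slack points [e i] let dominant sets of fewer than [#|I|] other points
   be completed to exactly [#|I|] points: [e i] is least for the order [i], so
   that it makes this order irrelevant, and above the non-slack points for the
   other orders. Doors are dominant sets with [#|I| - 1] points. *)
Section scarf_slack.
Variables (I Y : finType) (r : I -> Y -> nat) (e : I -> Y).
Hypothesis I_gt1 : 1 < #|I|.
Hypothesis e_inj : injective e.
Hypothesis r_inj : forall i, injective (r i).
Hypothesis r_slack_min : forall i y, y != e i -> r i (e i) < r i y.
Hypothesis r_slack_max :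
  forall i k y, k != i -> (forall j, y != e j) -> r k y < r k (e i).

(** Scarf's primitive sets, in a form that makes sense for any cardinality: no point exceeds, for
    all the orders at once, the least points of [S]. *)
Definition dominant (S : {set Y}) :=
  [forall x, exists i, forall y in S, r i x <= r i y].

Let dominantP (S : {set Y}) :
  reflect (forall x, exists i, forall y,
    y \in S -> r i x <= r i y) (dominant S).
Proof.
apply: (iffP forallP) => h x; have := h x.
  by move=> /existsP[i /forallP hi]; exists i => y; apply/implyP.
by move=> [i hi]; apply/existsP; exists i; apply/forallP => y; apply/implyP/hi.
Qed.

Let dominantS (S T : {set Y}) : S \subset T -> dominant T -> dominant S.
Proof.
move=> /fintype.subsetP ST /dominantP dT; apply/dominantP => x.
by have [i hi] := dT x; exists i => y /ST; exact: hi.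
Qed.

(** * The rooms containing a given door *)

Section door.
Variable T : {set Y}.
Hypothesis T_dom : dominant T.
Hypothesis T_card : #|T|.+1 = #|I|.

Let t0 : {t | t \in T}.
Proof.
apply/sigW/set0Pn; rewrite -card_gt0.
by move: I_gt1; rewrite -T_card ltnS.
Qed.

Let m (i : I) : Y := [arg min_(y < sval t0 in T) r i y].

Let mT i : m i \in T.
Proof. by rewrite /m; case: arg_minnP => //; exact: (svalP t0). Qed.

Let m_min i y : y \in T -> r i (m i) <= r i y.
Proof.
by move=> yT; rewrite /m; case: arg_minnP => [|z _ /(_ y yT)//];
  exact: (svalP t0).
Qed.

Let m_uniq i y : y \in T -> r i y <= r i (m i) -> m i = y.
Proof.
by move=> yT h; apply: (r_inj (i := i)); apply/eqP; rewrite eqn_leq h m_min.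
Qed.

(** Dominance applied to a point of [T] itself gives an order for which this point is the least. *)
Let m_surj : [set m i | i in I] = T.
Proof.
apply/setP => y; apply/imsetP/idP => [[i _ ->]//|yT].
have /dominantP/(_ y)[i hi] := T_dom; exists i => //.
by apply/esym/m_uniq => //; exact: hi.
Qed.

Definition above (k : I) (z : Y) := [forall (l | l != k), r l (m l) < r l z].

Let aboveP k z : reflect (forall l, l != k -> r l (m l) < r l z) (above k z).
Proof. exact: 'forall_implyP. Qed.

Definition pivot (k : I) (z : Y) :=
  above k z && [forall (z' | above k z'), r k z' <= r k z].

(** Dominance at [z] gives an order for which [z] is below all of [T]; being above for the other
    orders leaves only [k]. *)
Let above_le k z : above k z -> r k z <= r k (m k).
Proof.
move=> /aboveP h; have /dominantP/(_ z)[l hl] := T_dom.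
have [<-|lk] := eqVneq l k; first exact: hl.
by have := hl _ (mT l); rewrite leqNgt h.
Qed.

Let card_pivot k : #|[set z | pivot k z]| = [exists z, above k z] :> nat.
Proof.
case: existsP => [[z hz]|h].
  have [z' h' max'] := @arg_maxnP _ z (above k) (r k) hz.
  rewrite [X in #|pred_of_set X|](_ : _ = [set z']) ?cards1//.
  apply/setP => x; rewrite !inE; apply/andP/eqP => [[ax /forall_inP mx]|->].
    by apply: (r_inj (i := k)); apply/eqP; rewrite eqn_leq (mx _ h') andbT;
      exact: max'.
  by split=> //; apply/forall_inP => w /max'.
apply/eqP; rewrite cards_eq0; apply/eqP/setP => x; rewrite !inE.
by apply/negP => /andP[ax _]; apply: h; exists x.
Qed.

Let card_setD1 k : #|[set: I] :\ k| = #|T|.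
Proof.
by have := cardsD1 k [set: I]; rewrite inE cardsT -T_card add1n => -[].
Qed.

(** Pigeonhole: there is one order more than there are points in [T]. *)
Lemma door_ends : exists2 ij : I * I, ij.1 != ij.2 & m ij.1 = m ij.2.
Proof.
have : ~~ injectiveb m.
  apply/injectiveP => mi; have := card_imset [set: I] mi.
  have -> : [set m x | x in [set: I]] = T.
    by rewrite -m_surj; apply/setP => y; apply/imsetP/imsetP => -[i]; exists i.
  by rewrite cardsT -T_card => /n_Sn.
by move=> /injectivePn[i [j ij mij]]; exists (j, i); rewrite 1?eq_sym.
Qed.

Section ends.
Variables i j : I.
Hypothesis ij : i != j.
Hypothesis mij : m i = m j.

(** If [z |: T] is dominant, [z] is its least point for some order [k], and each point of [T] is
    least for an order where [z] is greater. By counting, these are all the orders but [k], and [m]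
    is injective on them: [z] is above for them, and [k] must be [i] or [j]. Dominance at a
    competitor [z'] makes [z] the greatest candidate. Conversely, let [z] be a pivot for [k]: the
    order [k] shows dominance at the points that are above, and an order where a point fails to be
    above shows it at that point. *)
Let room_pivot z : (z \notin T) && dominant (z |: T) = pivot i z || pivot j z.
Proof.
apply/andP/orP => [[zT /dominantP zdom]|].
  have [k hk] := zdom z.
  have kz : r k z < r k (m k).
    rewrite ltn_neqAle hk ?andbT; last by rewrite !inE mT orbT.
    apply: contra zT => /eqP/(r_inj (i := k)) ->; exact: mT.
  have cov : [set m l | l in [set l | r l (m l) < r l z]] = T.
    apply/setP => y; apply/imsetP/idP => [[x _ ->]//|yT].
    have [l hl] := zdom y.
    have ml : m l = y by apply: m_uniq => //; apply: hl; rewrite !inE mT orbT.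
    exists l => //; rewrite inE ml ltn_neqAle hl ?andbT;
      last by rewrite !inE eqxx.
    by apply: contra zT => /eqP/(r_inj (i := l)) <-.
  have eqD : [set l | r l (m l) < r l z] = [set: I] :\ k.
    have := leq_imset_card m [set l | r l (m l) < r l z]; rewrite cov => leT.
    apply/eqP; rewrite eqEcard card_setD1 leT andbT;
      apply/fintype.subsetP => l; rewrite !inE andbT.
    by apply: contraTN => /eqP ->; rewrite -leqNgt ltnW.
  have ak : above k z.
    by apply/aboveP => l lk; have := in_setD1 l [set: I] k;
      rewrite -eqD !inE lk.
  have pk : pivot k z.
    rewrite /pivot ak; apply/forall_inP => z' /aboveP az'.
    have [l hl] := zdom z'.
    have [<-|lk] := eqVneq l k; first by apply: hl; rewrite !inE eqxx.
    have := az' _ lk; rewrite ltnNge hl// !inE mT orbT //.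
  have : k \in [set i; j].
    have : {in [set: I] :\ k &, injective m}.
      by apply/imset_injP; rewrite card_setD1 -eqD cov.
    move=> /(_ i j); rewrite !inE !andbT.
    have [->|ik] := eqVneq i k; first by [].
    have [->|jk] := eqVneq j k; first by [].
    by move=> /(_ isT isT mij)/eqP; rewrite (negPf ij).
  by rewrite !inE => /orP[] /eqP <-; [left|right].
have main k l : k != l -> m k = m l -> pivot k z ->
  z \notin T /\ dominant (z |: T).
  move=> kl mkl /andP[az /forall_inP mz]; split.
    apply/negP => zT; have zm : m k = z by apply: m_uniq => //; exact: above_le.
    by move/aboveP : az => /(_ l); rewrite eq_sym kl -mkl zm ltnn => /(_ isT).
  apply/dominantP => x; have [ax|] := boolP (above k x).
    exists k => y; rewrite !inE => /orP[/eqP ->|yT]; first exact: mz.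
    by rewrite (leq_trans (above_le ax))// m_min.
  rewrite negb_forall_in => /exists_inP[l' lk']; rewrite -leqNgt => hl.
  exists l' => y; rewrite !inE => /orP[/eqP ->|yT].
    by rewrite (leq_trans hl)// ltnW//; move/aboveP : az; exact.
  by rewrite (leq_trans hl)// m_min.
by move=> []; [exact: main ij mij|apply: (main _ i); rewrite 1?eq_sym].
Qed.

(* Exactly two orders [i] and [j] have the same least point in the door. A room
   containing the door is obtained by adding, for one of them, the greatest
   point for this order among those above the door for all the others. *)
Lemma card_rooms :
  #|[set z in ~: T | dominant (z |: T)]| =
  [exists z, above i z] + [exists z, above j z] :> nat.
Proof.
rewrite -!card_pivot -cardsUI [X in _ = _ + #|pred_of_set X|]
  (_ : _ = finset.set0).
  rewrite cards0 addn0; congr #|pred_of_set _|.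
  by apply/setP => z; rewrite !inE room_pivot.
apply/setP => z; rewrite !inE; apply/negP => /andP[/andP[ai _] /andP[aj _]].
move/aboveP : aj => /(_ i ij); rewrite ltnNge => /negP; apply.
exact: above_le.
Qed.

End ends.

(** For every order other than [k], the least point of [T] is at most [y], hence below [e k]. So
    [e k] is always a candidate, and both terms of [card_rooms] are 1. *)
Lemma card_rooms_inner y : y \in T -> (forall k, y != e k) ->
  #|[set z in ~: T | dominant (z |: T)]| = 2.
Proof.
move=> yT ye; have ak k : above k (e k).
  apply/aboveP => l lk; apply: leq_ltn_trans (m_min l yT) _.
  by apply: r_slack_max; rewrite // eq_sym.
have [[i j] /= ij mij] := door_ends; rewrite (card_rooms ij mij).
by do 2 (case: existsP => [_|[]]; last by eexists; exact: ak).
Qed.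

(** Here [m k = e k] for [k != i], and [m i = e j] for some [j]. The point [e i] is a candidate for
    the order [i]. For the order [j] there is none: a candidate would exceed [e j] for the order
    [i], which excludes [e j], [e i] and the non-slack points, and another [e l] does not exceed
    [m l]. *)
Lemma card_rooms_outer i : T = [set e k | k in [set: I] :\ i] ->
  #|[set z in ~: T | dominant (z |: T)]| = 1.
Proof.
move=> Te; have me k : k != i -> m k = e k.
  move=> ki; apply: m_uniq; first by rewrite Te; apply/imset_f; rewrite !inE ki.
  by have [->//|mk] := eqVneq (m k) (e k); rewrite ltnW// r_slack_min.
have [j ij mij] : exists2 j, i != j & m i = m j.
  have [[k l] /= kl mkl] := door_ends.
  have [<-|ki] := eqVneq k i; first by exists l.
  have [li|li] := eqVneq l i; last first.
    by move: mkl; rewrite (me _ ki) (me _ li) => /e_inj/eqP; rewrite (negPf kl).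
  by exists k; rewrite -li; [rewrite eq_sym|].
have ji : j != i by rewrite eq_sym.
rewrite (card_rooms ij mij); case: existsP => [_|[]]; last first.
  exists (e i); apply/aboveP => l li.
  by rewrite me// r_slack_min// inj_eq// eq_sym.
case: existsP => [[z /aboveP az]|//]; exfalso.
have [|/existsPn ze] := boolP [exists l, z == e l].
  move=> /existsP[l /eqP zl]; move: az; rewrite {}zl => az.
  have [li|li] := eqVneq l i; last first.
    have [lj|lj] := eqVneq l j; last by have := az _ lj; rewrite me// ltnn.
    by have := az _ ij; rewrite mij me// lj ltnn.
  have := az _ ij; rewrite mij me// li ltnNge => /negP; apply.
  by have [->//|je] := eqVneq (e j) (e i); rewrite ltnW// r_slack_min.
have := az _ ij; rewrite mij me// ltnNge => /negP; apply.
by rewrite ltnW// r_slack_max.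
Qed.

End door.

(** * Colourings and the parity argument *)

Section coloring.
Variables (c : Y -> I).
Hypothesis c_slack : forall i, c (e i) = i.

Definition room (S : {set Y}) := dominant S && (#|S| == #|I|).

(** If removing [x] leaves all the colours but [i], each exactly once, then [c x] is not [i], so [x]
    shares its colour with a unique [y]. Only [x] and [y] can be removed in this way. *)
Lemma even_subdoors (i : I) (S : {set Y}) : #|S| = #|I| -> c @: S != [set: I] ->
  2 %| #|[set x in S | c @: (S :\ x) == [set: I] :\ i]|.
Proof.
move=> cardS cS; set W := [set x in S | _].
have [->|] := eqVneq W finset.set0; first by rewrite cards0.
move=> /set0Pn[x]; rewrite inE => /andP[xS /eqP cx].
have cx_i : c x != i.
  apply: contra cS => /eqP cxi; apply/eqP.
  by rewrite -(finset.setD1K xS) imsetU1 cx cxi finset.setD1K.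
have inj : {in S :\ x &, injective c}.
  apply/imset_injP/eqP; rewrite cx; apply: succn_inj.
  have := cardsD1 x S; have := cardsD1 i [set: I].
  by rewrite inE xS !add1n cardsT cardS => -> ->.
have : c x \in c @: (S :\ x) by rewrite cx !inE cx_i.
move=> /imsetP[y yS cxy];
  have /andP[yx yS'] : (y != x) && (y \in S) by rewrite -in_setD1.
have xy : x != y by rewrite eq_sym.
suff -> : W = [set x; y].
  by rewrite cards2 xy.
apply/setP => z; rewrite !inE; apply/andP/orP => [[zS /eqP cz]|[]/eqP ->].
- apply/orP; apply: contraT; rewrite negb_or => /andP[zx zy].
  have zD : z \in S :\ x by rewrite !inE zx.
  have : c z \in c @: (S :\ z) by rewrite cz -cx imset_f.
  move=> /imsetP[w]; rewrite !inE => /andP[wz wS] czw.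
  have [wx|wx] := eqVneq w x.
    by case/eqP: zy; apply: inj => //; rewrite czw wx.
  by case/eqP: wz; apply/esym/inj => //; rewrite !inE wx.
- by rewrite cx.
- split=> //; apply/eqP; rewrite -cx; apply/setP => k.
  apply/imsetP/imsetP => -[w]; rewrite !inE => /andP[w1 wS] ->.
    have [->|wx] := eqVneq w x; first by exists y => //; rewrite !inE yx.
    by exists w => //; rewrite !inE wx.
  have [->|wy] := eqVneq w y; first by exists x => //; rewrite !inE xy.
  by exists w => //; rewrite !inE wy.
Qed.

(* Count modulo 2 the pairs of a room and one of its points such that the other
   points have all the colours but [i]: a room without all the colours has an
   even number of such points, while a door belongs to two rooms, except for the
   door made of the slack points other than [e i]. *)
Lemma exists_full_room : exists2 S, room S & c @: S = [set: I].
Proof.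
have [i _] : exists i : I, true.
  have : 0 < #|I| by rewrite ltnW.
  by move=> /card_gt0P[i _]; exists i.
have [/exists_inP[S rS /eqP cS]|/exists_inPn noroom] :=
    boolP [exists (S | room S), c @: S == [set: I]].
  by exists S.
pose Q := [set p : {set Y} * Y | [&& room p.1, p.2 \in p.1 &
  c @: (p.1 :\ p.2) == [set: I] :\ i]].
exfalso; have : 2 %| #|Q|.
  rewrite -sum1_card (partition_big fst predT)//=; apply: dvdn_sum => S _.
  rewrite sum1_card; have [rS|rS] := boolP (room S); last first.
    rewrite eq_card0// => -[T y]; rewrite unfold_in /= inE /=; apply/negP.
    by move=> /andP[/and3P[rT _ _] /eqP TS]; move: rS; rewrite -TS rT.
  have /andP[dS /eqP cardS] := rS.
  rewrite (_ : #|_| = #|[set x in S | c @: (S :\ x) == [set: I] :\ i]|).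
    by apply: even_subdoors => //; exact: noroom.
  have inj : injective (fun x : Y => (S, x)) by move=> ? ? [].
  rewrite -(card_imset (mem [set x in S | c @: (S :\ x) == [set: I] :\ i]) inj).
  apply: eq_card => -[T y]; rewrite unfold_in /= inE /=; apply/idP/imsetP.
    by move=> /andP[/and3P[_ yT cT] /eqP TS]; exists y; rewrite -?TS ?inE ?yT.
  by move=> [x]; rewrite inE => /andP[xS cx] [-> ->]; rewrite rS xS cx eqxx.
pose T0 := [set e k | k in [set: I] :\ i].
have cT0 : c @: T0 = [set: I] :\ i.
  have ce : c \o e =1 id by move=> k; exact: c_slack.
  by rewrite -imset_comp (eq_imset _ ce) imset_id.
have fiber (T : {set Y}) : c @: T = [set: I] :\ i -> #|T|.+1 = #|I| ->
    \sum_(p in Q | p.1 :\ p.2 == T) 1 = #|[set z in ~: T | dominant (z |: T)]|.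
  move=> cT cardT; rewrite sum1_card.
  have inj : injective (fun z => (z |: T, z)) by move=> z w [].
  rewrite -(card_imset (mem [set z in ~: T | dominant (z |: T)]) inj);
    apply: eq_card => -[S z].
  rewrite unfold_in /= inE /=; apply/idP/imsetP.
    move=> /andP[/and3P[/andP[dS _] zS _] /eqP TS]; exists z.
      by rewrite !inE -TS !inE eqxx finset.setD1K.
    by rewrite -TS finset.setD1K.
  move=> [w]; rewrite !inE => /andP[wT dw] [-> ->].
  rewrite /room dw cardsU1 wT add1n cardT eqxx setU11 /=.
  by rewrite setU1K// cT !eqxx.
have cardT0 : #|T0|.+1 = #|I|.
  rewrite card_imset// -cardsT (cardsD1 i [set: I]) inE //.
have dT0 : dominant T0.
  apply/dominantP => x.
  have [/existsP[l /eqP ->]|/existsPn xe] := boolP [exists l, x == e l].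
    exists l => y _.
    by have [->//|ye] := eqVneq y (e l); rewrite ltnW// r_slack_min.
  exists i => y /imsetP[k]; rewrite !inE andbT => ki ->.
  by rewrite ltnW// r_slack_max// eq_sym.
rewrite -sum1_card (partition_big (fun p => p.1 :\ p.2) predT)//=.
rewrite (bigD1 T0)//= dvdn_addl; last first.
  apply: dvdn_sum => T TT0.
  have [cT|cT] := eqVneq (c @: T) ([set: I] :\ i); last first.
    rewrite big_pred0// => -[S z] /=; rewrite inE /=; apply/negP.
    by move=> /andP[/and3P[_ _ /eqP cS] /eqP TS]; move: cT; rewrite -TS cS eqxx.
  have [cardT|cardT] := eqVneq #|T|.+1 #|I|; last first.
    rewrite big_pred0// => -[S z] /=; rewrite inE /=; apply/negP.
    move=> /andP[/and3P[/andP[_ /eqP cardS] zS _] /eqP TS]; move/eqP: cardT.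
    by rewrite -TS -cardS (cardsD1 z S) zS.
  rewrite fiber//; have [dT|dT] := boolP (dominant T); last first.
    rewrite (_ : [set z in _ | _] = finset.set0) ?cards0//; apply/setP => z.
    rewrite !inE; apply/negP => /andP[_]; apply/negP; apply: contra dT.
    by apply: dominantS; exact: finset.subsetUr.
  have [/existsP[y /andP[yT /forallP ye]]|] :=
    boolP [exists y, (y \in T) && [forall k, y != e k]].
    by rewrite (card_rooms_inner dT cardT yT ye).
  (* The colours of a door made of slack points are their indices, so that this door lies in [T0]
     and equals it by cardinality. *)
  move=> /existsPn allslack; exfalso; move/eqP: TT0; apply.
  apply/eqP; rewrite eqEcard; apply/andP; split; last first.
    by rewrite -ltnS cardT0 cardT.
  apply/fintype.subsetP => y yT; have := allslack y; rewrite yT /=.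
  move=> /forallPn[k]; rewrite negbK => /eqP yk; rewrite yk; apply: imset_f.
  by rewrite -cT -(c_slack k) -yk imset_f.
by rewrite fiber// (card_rooms_outer dT0 cardT0 erefl).
Qed.

End coloring.
End scarf_slack.

(** One slack point [inr i], coloured [i], is added for each order. [C] consists of the orders whose
    slack point is absent from the full room: their colours must come from points of [X], and only
    they can show dominance at a point of [X], since [inr i] is below all of [X] for the order
    [i]. *)
Theorem scarf (I X : finType) (r : I -> X -> nat) (c : X -> I) :
  1 < #|I| -> 0 < #|X| -> (forall i, injective (r i)) ->
  exists (s : {set X}) (C : {set I}), [/\ s != finset.set0,
    forall i, i \in C -> exists2 y, y \in s & c y = i &
    forall x, exists2 i, i \in C & forall y, y \in s -> r i x <= r i y].
Proof.
move=> I_gt1 /card_gt0P[x0 _] r_inj.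
pose B i := \max_x r i x.
have rB i x : r i x <= B i by apply: (leq_bigmax (F := r i)).
(* The successor leaves the rank 0 to the slack point of the order; the other slack points start at
   [(B i).+2], above all points of [X], and [enum_rank] separates them. *)
pose rY i (y : X + I) := match y with
  | inl x => (r i x).+1
  | inr k => if k == i then 0 else ((B i).+2 + enum_rank k) end.
have rY_inj i : injective (rY i).
  move=> [x|k] [y|l] /=.
  - by move=> [] /r_inj ->.
  - by case: eqP => // _; have := rB i x; lia.
  - by case: eqP => // _; have := rB i y; lia.
  - case: eqP => [->|_]; case: eqP => [->|_] //.
    by move=> /addnI/ord_inj/enum_rank_inj ->.
have minY i y : y != inr i -> rY i (inr i) < rY i y.
  rewrite /rY eqxx; case: y => //= k.
  by have [->|//] := eqVneq k i; rewrite eqxx.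
have maxY i k y : k != i -> (forall j, y != inr j) -> rY k y < rY k (inr i).
  case: y => [x|l] ki yj; last by have := yj l; rewrite eqxx.
  by rewrite /= eq_sym (negPf ki); have := rB k x; lia.
have inr_inj : injective (@inr X I) by move=> ? ? [].
pose cY (y : X + I) := match y with inl x => c x | inr i => i end.
have [S /andP[/forallP dS _] cS] :=
  exists_full_room I_gt1 inr_inj rY_inj minY maxY (c := cY) (fun=> erefl).
have dom x : exists2 i, inr i \notin S &
    forall y, inl y \in S -> r i x <= r i y.
  have /existsP[i /forall_inP hi] := dS (inl x); exists i.
    by apply/negP => /hi; rewrite /= eqxx.
  by move=> y /hi.
exists [set x | inl x \in S], [set i | inr i \notin S]; split.
- apply/set0Pn; have [i iS _] := dom x0.
  have : i \in cY @: S by rewrite cS inE.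
  move=> /imsetP[[x|j] jS ij]; first by exists x; rewrite inE.
  by move: iS; rewrite ij /= jS.
- move=> i; rewrite inE => iS; have : i \in cY @: S by rewrite cS inE.
  move=> /imsetP[[x|j] jS ij]; first by exists x; rewrite ?inE.
  by move: iS; rewrite ij /= jS.
- move=> x; have [i iS hi] := dom x; exists i; rewrite ?inE// => y.
  by rewrite inE => /hi.
Qed.

(* Dominance forces the minima of the coordinates in [C] to have a sum greater
   than [n - #|C|], so that the points of [s] are close to each other. *)
Lemma scarf_grid (I : finType) (n : nat) (c : (I -> nat) -> I) :
  1 < #|I| -> exists y : I -> I -> nat, [/\ forall i, \sum_k y i k = n,
    forall i j k, y i k <= y j k + #|I| &
    forall i, c (y i) = i \/ y i i <= #|I|].
Proof.
move=> I_gt1.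
pose X : finType := {v : {ffun I -> 'I_n.+1} | \sum_k v k == n}.
pose co (x : X) k : nat := val x k.
have co_sum (x : X) : \sum_k co x k = n by apply/eqP; exact: (valP x).
have mkX (v : I -> nat) : \sum_k v k = n -> exists x : X, co x =1 v.
  move=> vn; have vk k : v k < n.+1 by rewrite ltnS -vn (bigD1 k)//= leq_addr.
  pose w : {ffun I -> 'I_n.+1} := [ffun k => Ordinal (vk k)].
  have wE k : w k = v k :> nat by rewrite ffunE.
  have wn : \sum_k w k == n by rewrite (eq_bigr _ (fun k _ => wE k)) vn.
  by exists (exist _ w wn).
(* Comparison of the coordinates [i], with ties broken by the enumeration of [X]. *)
pose r i x := co x i * #|X| + enum_rank x.
have r_inj i : injective (r i).
  move=> x y /(congr1 (modn^~ #|X|)); rewrite !modnMDl !modn_small//.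
  by move=> /ord_inj/enum_rank_inj.
have r_mono i x y : r i x <= r i y -> co x i <= co y i.
  rewrite leqNgt => h; rewrite leqNgt; apply: contra h => h; rewrite /r.
  apply: leq_trans (leq_addr _ _); apply: (@leq_trans ((co y i).+1 * #|X|)).
    by rewrite mulSnr ltn_add2l.
  by rewrite leq_mul2r h orbT.
have [i0 _] : exists i0 : I, true.
  by have /card_gt0P[i _] : 0 < #|I|; [rewrite ltnW|exists i].
have [x0 _] : exists x0 : X, true.
  have [|x _] := mkX (fun k => if k == i0 then n else 0); last by exists x.
  by rewrite -big_mkcond big_pred1_eq.
have X_gt0 : 0 < #|X| by apply/card_gt0P; exists x0.
have [s [C [/set0Pn[z zs] col dom]]] :=
  scarf (fun x => c (co x)) I_gt1 X_gt0 r_inj.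
pose m i := co [arg min_(y < z in s) co y i] i.
have m_min i y : y \in s -> m i <= co y i.
  by move=> ys; rewrite /m; case: arg_minnP => // w _; exact.
have m_att i : exists2 y, y \in s & m i = co y i.
  by rewrite /m; case: arg_minnP => // w ws _; exists w.
(* Otherwise a grid point has coordinates at least [(m i).+1] on all of [C], the excess of the total
   being put on some [k] in [C]; this contradicts dominance. *)
have m_big : n < \sum_(i in C) (m i).+1.
  rewrite ltnNge; apply/negP => mn.
  have [k kC _] := dom z.
  pose v i := (if i \in C then (m i).+1 else 0) +
              (if i == k then n - \sum_(i in C) (m i).+1 else 0).
  have [|x xv] := mkX v.
    by rewrite big_split -!big_mkcond /= big_pred1_eq subnKC.
  have [i iC hi] := dom x; have [y ys my] := m_att i.
  by have := r_mono _ _ _ (hi _ ys); rewrite xv -my /v iC; lia.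
have sumC : \sum_(i in C) (m i).+1 = \sum_(i in C) m i + #|C|.
  by rewrite -sum1_card -big_split /=; apply: eq_bigr => i _; rewrite addn1.
have CI : #|C| <= #|I| by exact: max_card.
(* The coordinates of [y] sum to [n], and those in [C] other than [i] are at least their minima, so
   [m_big] leaves little room for coordinate [i]. *)
have up y i : y \in s -> i \in C -> co y i <= m i + #|I|.
  move=> ys iC; have : \sum_(j in C) co y j <= n.
    by rewrite -(co_sum y) [X in _ <= X](bigID (mem C)) leq_addr.
  rewrite (bigD1 i)//=.
  have : \sum_(j in C | j != i) m j <= \sum_(j in C | j != i) co y j.
    by apply: leq_sum => j _; exact: m_min.
  move: m_big; rewrite sumC (bigD1 i)//= => h1 h2 h3.
  apply: (@leq_trans (m i + #|C|)); last by rewrite leq_add2l.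
  by clear -h1 h2 h3; lia.
have up0 y i : y \in s -> i \notin C -> co y i <= #|I|.
  move=> ys iC; have : co y i + \sum_(j in C) co y j <= n.
    rewrite -(co_sum y) [X in _ <= X](bigID (mem C)) /= addnC leq_add2l.
    by rewrite (bigD1 i) ?leq_addr.
  have : \sum_(j in C) m j <= \sum_(j in C) co y j.
    by apply: leq_sum => j _; exact: m_min.
  move: m_big; rewrite sumC => h1 h2 h3; apply: leq_trans CI.
  by clear -h1 h2 h3; lia.
have /fin_all_exists[y hy] : forall i, exists y,
  y \in s /\ (i \in C -> c (co y) = i).
  (* For [i] outside [C] any point of [s] serves: by [up0] its coordinate [i] is small. *)
  move=> i; have [iC|iC] := boolP (i \in C); last by exists z.
  by have [w ws cw] := col i iC; exists w.
exists (fun i => co (y i)); split.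
- by move=> i; exact: co_sum.
- move=> i j k; have [[yi _] [yj _]] := (hy i, hy j).
  have [kC|kC] := boolP (k \in C).
    by rewrite (leq_trans (up _ _ yi kC))// leq_add2r m_min.
  by rewrite (leq_trans (up0 _ _ yi kC))// leq_addl.
- move=> i; have [yi ci] := hy i.
  by have [/ci|/up0] := boolP (i \in C); [left|right; auto].
Qed.

Local Open Scope classical_set_scope.
Local Open Scope ring_scope.

(** * Random indices and the random Bolzano-Weierstrass theorem *)

Section random_index.
Context d1 d2 (T : measurableType d1) (S : measurableType d2).

Lemma measurable_fun_nat (N : T -> nat) :
  (forall n, measurable [set w | N w = n]) -> measurable_fun setT N.
Proof.
move=> mN _ Y _; rewrite setTI
  (_ : _ @^-1` Y = \bigcup_(n in Y) [set w | N w = n]).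
  by apply: bigcup_measurable => n _; exact: mN.
by apply/seteqP; split=> [w Yw|w [n Yn /= ->//]]; exists (N w).
Qed.

Lemma measurable_fun_index (N : T -> nat) (F : nat -> T -> S) :
  measurable_fun setT N -> (forall n, measurable_fun setT (F n)) ->
  measurable_fun setT (fun w => F (N w) w).
Proof.
move=> mN mF _ Y mY; rewrite setTI.
rewrite (_ : _ @^-1` Y = \bigcup_n (N @^-1` [set n] `&` F n @^-1` Y)).
  apply: bigcup_measurable => n _; apply: measurableI.
    by rewrite -[X in measurable X]setTI; exact: mN.
  by rewrite -[X in measurable X]setTI; exact: mF.
by apply/seteqP; split=> [w Yw|w [n _ [/= -> //]]]; exists (N w).
Qed.

(** [N] is the least index whose set contains [w], and 0 where there is none; its level sets are
    countable combinations of the [Q n]. *)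
Lemma measurable_select (Q : nat -> set T) :
  (forall n, measurable (Q n)) ->
  exists2 N : T -> nat, measurable_fun setT N &
    forall w n, Q n w -> Q (N w) w.
Proof.
move=> mQ.
have /choice[N HN] : forall w, exists k,
    (forall n, Q n w -> Q k w /\ (k <= n)%N) /\
    ((forall n, ~ Q n w) -> k = 0%N).
  move=> w.
  have [[n Qn]|nQ] := pselect (exists n, Q n w).
    have ex : exists n, `[< Q n w >] by exists n; apply/asboolP.
    have [k /asboolP Qk kmin] := ex_minnP ex; exists k; split=> [m Qm|/(_ k)//].
    by split=> //; apply: kmin; apply/asboolP.
  by exists 0%N; split=> // n Qn; exfalso; apply: nQ; exists n.
exists N; last by move=> w n /((HN w).1 n)[].
apply: measurable_fun_nat => n.
have mQC k : measurable (~` Q k) by apply: measurableC.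
have -> : [set w | N w = n] =
    (Q n `&` \bigcap_(k in [set k | (k < n)%N]) ~` Q k) `|`
    (if n == 0%N then \bigcap_k ~` Q k else set0).
  apply/seteqP; split=> [w /= Nn|w /=].
    have [[m Qm]|nQ] := pselect (exists n, Q n w).
      have [QN _] := (HN w).1 m Qm; rewrite Nn in QN; left;
        split=> // k /= kn Qk.
      by have [_] := (HN w).1 k Qk; rewrite Nn leqNgt kn.
    right; rewrite -Nn (HN w).2 ?eqxx; last by move=> m Qm; apply: nQ; exists m.
    by move=> k _ Qk; apply: nQ; exists k.
  case=> [[Qn nQ]|].
    have [QN Nn] := (HN w).1 n Qn; apply/eqP; rewrite eqn_leq Nn /= leqNgt.
    by apply/negP => /nQ; exact.
  by case: eqP => // -> nQ; apply: (HN w).2 => m; exact: nQ.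
apply: measurableU.
  by apply: measurableI => //; apply: bigcap_measurableType => k _; exact: mQC.
by case: ifP => // _; apply: bigcap_measurableType => k _; exact: mQC.
Qed.

End random_index.

Section random_bolzano_weierstrass.
Context d (T : measurableType d) (R : realType).

(** The tail suprema decrease to the upper limit. A tail far enough has its supremum just above this
    limit, and one of its terms is close to this supremum. *)
Lemma cluster_limsup (u : nat -> R) (M : R) (k : nat) :
  (forall n, `|u n| <= M) ->
  exists2 n, (k <= n)%N &
    `|u n - fine (limn_esup (EFin \o u))| < k.+1%:R^-1.
Proof.
move=> uM; set v := EFin \o u.
have -> : limn_esup v = ereal_inf (range (esups v)).
  by rewrite limn_esup_lim; apply/cvg_lim => //; exact: cvg_esups_inf.
set L := ereal_inf _.
have Lfin : L \is a fin_num.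
  rewrite fin_numElt; apply/andP; split.
    apply: (@lt_le_trans _ _ (- M)%:E); first exact: ltNyr.
    apply: le_ereal_inf_tmp => _ [n _ <-].
    apply: (@le_trans _ _ (v n)).
      by rewrite lee_fin; have := uM n; rewrite ler_norml => /andP[].
    by apply: ereal_sup_ubound; exists n => //=.
  apply: (@le_lt_trans _ _ M%:E); last exact: ltry.
  apply: (@le_trans _ _ (esups v 0%N)); first by apply: ereal_inf_lbound;
    exists 0%N.
  apply: ge_ereal_sup => _ [n _ <-].
  by rewrite lee_fin; have := uM n; rewrite ler_norml => /andP[].
have e_gt0 : 0 < k.+1%:R^-1 :> R by rewrite invr_gt0.
have [_ [n0 _ <-] Ln0] := lb_ereal_inf_adherent e_gt0 Lfin.
have Ln : (L - (k.+1%:R^-1)%:E < esups v (maxn n0 k))%E.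
  apply: (@lt_le_trans _ _ L); last by apply: ereal_inf_lbound;
    exists (maxn n0 k).
  by rewrite lteBlDr// lteDl// lte_fin.
have [_ [m /= km <-] um] := ereal_sup_gt Ln.
exists m; first by rewrite (leq_trans _ km)// leq_maxr.
have : (v m < L + (k.+1%:R^-1)%:E)%E.
  apply: le_lt_trans Ln0; apply: (@le_trans _ _ (esups v (maxn n0 k))).
    by apply: ereal_sup_ubound; exists m.
  by apply: nonincreasing_esups; exact: leq_maxl.
move: um; rewrite -{1 2}(fineK Lfin) -EFinB -EFinD !lte_fin => h1 h2.
by rewrite ltr_distl h1 h2.
Qed.

(** The upper limit is taken as the limit because it depends measurably on the sample point. [N k]
    need not increase with [k]: the bound [k <= N k w] suffices for the later uses. *)
Lemma random_subseq_real (u : nat -> T -> R) :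
  (forall n, measurable_fun setT (u n)) ->
  exists (l : T -> R) (N : nat -> T -> nat),
  [/\ measurable_fun setT l, forall k, measurable_fun setT (N k) &
    forall w M, (forall n, `|u n w| <= M) ->
      forall k, (k <= N k w)%N /\ `|u (N k w) w - l w| < k.+1%:R^-1].
Proof.
move=> mu; pose l w := fine (limn_esup (EFin \o u^~ w)).
have ml : measurable_fun setT l.
  apply: measurableT_comp => //.
  apply: (@measurable_fun_limn_esup _ _ _ setT (fun n w => (u n w)%:E)) => n.
  by apply/measurable_EFinP; exact: mu.
have /choice[N HN] : forall k, exists Nk : T -> nat, measurable_fun setT Nk /\
    forall w M, (forall n, `|u n w| <= M) ->
      (k <= Nk w)%N /\ `|u (Nk w) w - l w| < k.+1%:R^-1.
  move=> k; have [|Nk mNk HNk] := @measurable_select _ T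
      (fun n => [set w | (k <= n)%N /\ `|u n w - l w| < k.+1%:R^-1]).
    move=> n; have [kn|kn] := leqP k n; last first.
      by rewrite (_ : [set _ | _] = set0)//; apply/seteqP; split=> // w [].
    rewrite (_ : [set _ | _] =
      (fun w => `|u n w - l w| < k.+1%:R^-1) @^-1` [set true]).
      rewrite -[X in measurable X]setTI; apply: measurable_fun_ltr => //.
      by apply: measurableT_comp => //; apply: measurable_funB.
    by apply/seteqP; split=> [w []|w].
  exists Nk; split=> // w M uM.
  by have [n kn un] := cluster_limsup k uM; exact: (HNk w n).
by exists l, N; split=> // [k|w M uM k]; [exact: (HN k).1|exact: (HN k).2 uM].
Qed.

End random_bolzano_weierstrass.

(** * The Euclidean distance on tuples *)

Section eucdist.
Context (R : realType) (d : nat).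
Implicit Types u v s : d.-tuple R.

Definition eucdist u v : R := euclid [tuple tnth u i - tnth v i | i < d].

Lemma eucdist_ge0 u v : 0 <= eucdist u v. Proof. exact: euclid_ge0. Qed.

Lemma sqr_eucdist u v : eucdist u v ^+ 2 =
  \sum_(i < d) (tnth u i - tnth v i) ^+ 2.
Proof. by rewrite sqr_euclid; apply: eq_bigr => i _; rewrite tnth_mktuple. Qed.

Lemma eucdistC u v : eucdist u v = eucdist v u.
Proof.
apply/eqP; rewrite -(eqrXn2 (n := 2)) ?eucdist_ge0// !sqr_eucdist; apply/eqP.
by apply: eq_bigr => i _; rewrite -sqrrN opprB.
Qed.

Lemma eucdist_triangle u v s : eucdist u s <= eucdist u v + eucdist v s.
Proof. by apply: euclid_triangle => i; rewrite !tnth_mktuple addrA subrK. Qed.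

Lemma eucdist_eq0 u v : eucdist u v = 0 -> u = v.
Proof.
move=> /euclid_eq0 uv; apply: eq_from_tnth => i.
by apply/eqP; rewrite -subr_eq0; have := uv i; rewrite tnth_mktuple => ->.
Qed.

Lemma eucdistxx u : eucdist u u = 0.
Proof.
apply/eqP; rewrite -sqrf_eq0 sqr_eucdist big1// => i _.
by rewrite subrr expr0n.
Qed.

Lemma tnth_le_euclid u i : `|tnth u i| <= euclid u.
Proof.
rewrite -(ler_pXn2r (n := 2)) ?nnegrE ?euclid_ge0// sqr_euclid.
rewrite real_normK ?num_real// (bigD1 i)//= lerDl.
by apply: sumr_ge0 => j _; exact: sqr_ge0.
Qed.

Lemma tnth_le_eucdist u v i : `|tnth u i - tnth v i| <= eucdist u v.
Proof.
by have := tnth_le_euclid [tuple tnth u i - tnth v i | i < d] i;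
  rewrite tnth_mktuple.
Qed.

Lemma eucdist_le_sum u v : eucdist u v <= \sum_(i < d) `|tnth u i - tnth v i|.
Proof.
rewrite -(ler_pXn2r (n := 2)) ?nnegrE ?eucdist_ge0 ?sumr_ge0// sqr_eucdist.
suff : 0 <= \sum_(i < d) `|tnth u i - tnth v i| /\
    \sum_(i < d) (tnth u i - tnth v i) ^+ 2 <=
    (\sum_(i < d) `|tnth u i - tnth v i|) ^+ 2 by case.
apply: (big_ind2 (fun x y => 0 <= y /\ x <= y ^+ 2)) =>
  [|a x b y [x0 ax] [y0 by_]|i _].
- by rewrite expr0n.
- split; first exact: addr_ge0.
  by apply: le_trans (lerD ax by_) _;
    rewrite sqrrD lerD2r lerDl mulrn_wge0// mulr_ge0.
- by rewrite real_normK ?num_real.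
Qed.

End eucdist.

Section random_bolzano_weierstrass_tuple.
Context dT (T : measurableType dT) (R : realType) (d : nat).

(** Induction on the number [j] of coordinates that already converge, with a further random
    subsequence taken for each new coordinate. *)
Lemma random_subseq (X : nat -> T -> d.-tuple R) :
  (forall n, measurable_fun setT (X n)) ->
  exists (x : T -> d.-tuple R) (N : nat -> T -> nat),
  [/\ measurable_fun setT x, forall k, measurable_fun setT (N k) &
    forall w M, (forall n i, `|tnth (X n w) i| <= M) ->
      forall k, (k <= N k w)%N /\ eucdist (X (N k w) w) (x w) < k.+1%:R^-1].
Proof.
move=> mX; have mXi n i : measurable_fun setT (fun w => tnth (X n w) i).
  exact: (measurable_fun_tnthP (X n)).1.
suff /(_ d)[x [N [mx mN HN]]] : forall j,
    exists (x : 'I_d -> T -> R) (N : nat -> T -> nat),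
    [/\ forall i, measurable_fun setT (x i),
      forall k, measurable_fun setT (N k) &
    forall w M, (forall n i, `|tnth (X n w) i| <= M) ->
      forall k, (k <= N k w)%N /\ forall i : 'I_d, (i < j)%N ->
        `|tnth (X (N k w) w) i - x i w| < k.+1%:R^-1].
  (* The Euclidean distance is at most the sum of [d] coordinate errors; the index [d.+1 * k.+1]
     makes this sum less than [k.+1%:R^-1]. *)
  exists (fun w => [tuple x i w | i < d]), (fun k => N (d.+1 * k.+1)%N);
    split=> //.
    exact: measurable_mktuple.
  move=> w M XM k; have [kN xN] := HN w M XM (d.+1 * k.+1)%N; split.
    by apply: leq_trans kN; nia.
  apply: le_lt_trans (eucdist_le_sum _ _) _.
  apply: (@le_lt_trans _ _ (\sum_(i < d) (d.+1 * k.+1).+1%:R^-1)).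
    by apply: ler_sum => i _; rewrite tnth_mktuple ltW// xN.
  rewrite sumr_const card_ord -[_ *+ d]mulr_natl ltr_pdivrMr// mulrC.
  rewrite ltr_pdivlMr// -natrM ltr_nat; nia.
elim=> [|j [x [N [mx mN HN]]]].
  by exists (fun _ _ => 0), (fun k _ => k); split=> // i; exact: measurable_cst.
have [jd|dj] := ltnP j d; last first.
  exists x, N; split=> // w M XM k; have [kN xN] := HN w M XM k;
    split=> // i ij.
  by apply: xN; rewrite (leq_trans (ltn_ord i)).
pose j' := Ordinal jd.
have [|l [N' [ml mN' HN']]] := @random_subseq_real _ T R
    (fun k w => tnth (X (N k w) w) j').
  by move=> k; apply: (measurable_fun_index (F := fun n w => tnth (X n w) j')).
(* The earlier coordinates keep their rate under the composition of indices because
   [k <= N' k w]. *)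
exists (fun i => if i == j' then l else x i), (fun k w => N (N' k w) w).
split=> [i|k|w M XM k].
- by case: ifP.
- exact: measurable_fun_index.
- have [kN' lN'] := HN' w M (fun n => XM _ j') k.
  have [kN xN] := HN w M XM (N' k w); split; first exact: leq_trans kN' kN.
  move=> i; rewrite ltnS leq_eqVlt => /orP[/eqP ij|ij].
    have -> : i = j' by exact: val_inj.
    by rewrite eqxx.
  have -> : (i == j') = false by apply/negbTE; rewrite -val_eqE /= ltn_eqF.
  by apply: lt_le_trans (xN i ij) _; rewrite lef_pV2 ?posrE// ler_nat ltnS.
Qed.

End random_bolzano_weierstrass_tuple.

(** * The projection onto a closed convex set *)

Section L0_tools.
Context dT (T : measurableType dT) (R : realType) (P : probability T R)
  (d : nat).
Implicit Types (x y z : L0vec P d) (G : set (L0vec P d)).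

Lemma measurable_eucdist (u v : T -> d.-tuple R) :
  measurable_fun setT u -> measurable_fun setT v ->
  measurable_fun setT (fun w => eucdist (u w) (v w)).
Proof.
move=> /measurable_fun_tnthP mu /measurable_fun_tnthP mv.
apply: (measurableT_comp (continuous_measurable_fun (@sqrt_continuous R))).
apply: measurable_sum => i; apply: measurable_funX.
under eq_fun do rewrite tnth_mktuple.
by apply: measurable_funB; [exact: mu|exact: mv].
Qed.

Lemma L0norm_eucdist x y : {ae P, forall w,
  L0norm (x - y) w = eucdist (x w) (y w)}.
Proof.
apply: (ae_mp (L0normE (x - y))); apply: (ae_mp (L0vec_DE x (- y))).
apply: (ae_mp (L0vec_NE y)); apply: nearW => w yE xyE ->.
by congr euclid; apply: eq_from_tnth => i; rewrite tnth_mktuple xyE yE.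
Qed.

Lemma L0_ballE x (r : L0 P) y :
  L0_ball x r y <-> {ae P, forall w, eucdist (x w) (y w) < r w}.
Proof.
split=> h; apply: (ae_mp h); apply: (ae_mp (L0norm_eucdist x y)).
  by apply: nearW => w ->.
by apply: nearW => w ->.
Qed.

Lemma index_partition (N : T -> nat) : measurable_fun setT N ->
  exists A : countable_partition T, forall n w, A n w <-> N w = n.
Proof.
move=> mN; have mA n : measurable [set w | N w = n].
  by rewrite -[X in measurable X]setTI; exact: (mN measurableT [set n]).
have tA : trivIset setT (fun n => [set w | N w = n]).
  by move=> m n _ _ [w [/= <- <-]].
have cA : \bigcup_n [set w | N w = n] = setT.
  by apply/seteqP; split=> // w _; exists (N w).
by exists (Build_countable_partition mA tA cA).
Qed.

Lemma concat_index (A : countable_partition T) (N : T -> nat)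
    (x : nat -> L0vec P d) :
  (forall n w, A n w <-> N w = n) ->
  {ae P, forall w, concat A x w = x (N w) w}.
Proof.
move=> AN; apply: (ae_mp (ae_foralln (concatE A x))); apply: nearW => w; apply.
by rewrite AN.
Qed.

Lemma stable_select G (N : T -> nat) (x : nat -> L0vec P d) :
  sigma_stable G -> measurable_fun setT N -> (forall n, G (x n)) ->
  exists2 z, G z & {ae P, forall w, z w = x (N w) w}.
Proof.
move=> sG mN Gx; have [A AN] := index_partition mN.
by exists (concat A x); [exact: sG|exact: concat_index].
Qed.

Lemma stable_map_select G (f : L0vec P d -> L0vec P d) (N : T -> nat)
    (x : nat -> L0vec P d) z :
  sigma_stable_map G f -> measurable_fun setT N -> (forall n, G (x n)) ->
  {ae P, forall w, z w = x (N w) w} ->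
  {ae P, forall w, f z w = f (x (N w)) w}.
Proof.
move=> [sG sf] mN Gx zx; have [A AN] := index_partition mN.
have -> : z = concat A x.
  apply/ae_class_eqP; apply: (ae_mp zx); apply: (ae_mp (concat_index x AN)).
  by apply: nearW => w -> ->.
by rewrite sf//; exact: (concat_index (f \o x) AN).
Qed.

(** If [z] were outside [G], a ball of random radius [r] around [z] would miss [G]. Gluing, at each
    sample point, the first [x n] within [r] of [z] gives a point of [G] in this ball. *)
Lemma closed_select G (x : nat -> L0vec P d) z :
  closed G -> sigma_stable G -> (forall n, G (x n)) ->
  {ae P, forall w e, 0 < e -> exists n, eucdist (x n w) (z w) < e} -> G z.
Proof.
move=> cG sG Gx xz; apply: contrapT => nGz.
have /L0_openP/(_ z nGz)[r r_gt0 rG] : open (~` G) by apply: closed_openC.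
have [|N mN HN] := @measurable_select _ T
    (fun n => [set w | eucdist (x n w) (z w) < r w]).
  move=> n; rewrite -[X in measurable X]setTI; apply: measurable_fun_ltr => //.
    by apply: measurable_eucdist; exact: measurable_repr.
have [y Gy yx] := stable_select sG mN Gx.
apply: (rG y) => //; apply/L0_ballE.
apply: (ae_mp yx); apply: (ae_mp xz); apply: (ae_mp r_gt0).
apply: (ae_mp (L0_0E P)); apply: nearW => w z0 /[!z0] rw xzw ->.
by rewrite eucdistC; have [n] := xzw _ rw; exact: HN.
Qed.

Lemma within_continuous_ball G (f : L0vec P d -> L0vec P d) x (e : L0 P) :
  {within G, continuous f} -> G x -> L0_pp e ->
  exists2 r, L0_pp r & forall y, G y -> L0_ball x r y -> L0_ball (f x) e (f y).
Proof.
move=> cf Gx e_gt0.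
have nb (z : L0vec P d) (s : L0 P) : L0_pp s -> nbhs z (L0_ball z s).
  move=> s0; rewrite nbhsE /=; exists (L0_ball z s); last exact.
  split; last exact: L0_ball_center.
  by apply/L0_openP => t zt; have [r r0 sub] := L0_ballI zt zt;
    exists r => // u /sub[].
move/subspace_continuousP : cf => /(_ x Gx (L0_ball (f x) e) (nb _ _ e_gt0)).
rewrite nbhs_simpl /= /within /= nbhsE /=.
move=> [U [oU Ux] UG]; have [r r0 rU] := (L0_openP U).1 oU x Ux.
by exists r => // y Gy xy; apply: UG => //; exact: rU.
Qed.

Lemma as_bounded_euclid G : as_bounded G ->
  exists2 xi : L0 P, {ae P, forall w, 0 <= xi w} &
    forall x, G x -> {ae P, forall w, euclid (x w) <= xi w}.
Proof.
move=> [xi xi0 [ub _]]; exists xi.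
  by have := (L0_leP 0 xi).1 xi0 => h; apply: (ae_mp h);
    apply: (ae_mp (L0_0E P)); apply: nearW => w ->.
move=> x Gx; have := ub _ (ex_intro2 _ _ x Gx erefl) => /L0bar_leP h.
apply: (ae_mp h); apply: (ae_mp (L0_EFinE xi)).
apply: (ae_mp (L0_EFinE (L0norm x))); apply: (ae_mp (L0normE x)).
by apply: nearW => w <- -> ->; rewrite lee_fin.
Qed.

End L0_tools.

Lemma le0_harmonic (R : realType) (s c : R) :
  (forall k : nat, s <= c * k.+1%:R^-1) -> s <= 0.
Proof.
move=> sc; rewrite leNgt; apply/negP => s0.
have c0 : 0 < c by have := sc 0%N; rewrite invr1 mulr1; exact: lt_le_trans.
have [|k] := @ltr_add_invr R 0 (s / c); first by rewrite divr_gt0.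
by rewrite add0r ltr_pdivlMr// mulrC ltNge sc.
Qed.

(** * Nearest points in Euclidean space *)

Section obtuse.
Context (R : realType) (d : nat).
Implicit Types x y z : d.-tuple R.

Definition dot_from z x y : R :=
  \sum_(i < d) (tnth x i - tnth z i) * (tnth y i - tnth z i).

(** Moving from [z] towards [y] by a fraction [l] changes the squared distance to [x] by
    [- 2 * l * dot_from z x y] plus a term in [l ^+ 2]; divide by [l] and let it tend to 0. The
    fractions form a sequence, so that almost sure hypotheses can be combined. *)
Lemma obtuse_of_nearest x y z :
  (forall k v, (forall i, tnth v i =
    k.+1%:R^-1 * tnth y i + (1 - k.+1%:R^-1) * tnth z i) ->
     eucdist x z <= eucdist x v) ->
  dot_from z x y <= 0.
Proof.
move=> h; apply:
  (@le0_harmonic _ _ (\sum_(i < d) (tnth y i - tnth z i) ^+ 2)) => k.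
set l : R := k.+1%:R^-1; have l0 : 0 < l by rewrite invr_gt0.
have := h k [tuple l * tnth y i + (1 - l) * tnth z i | i < d] _.
move=> /(_ (fun i => tnth_mktuple _ _)).
rewrite -(ler_pXn2r (n := 2)) ?nnegrE ?eucdist_ge0// !sqr_eucdist.
have -> : \sum_(i < d) (tnth x i -
      tnth [tuple l * tnth y i + (1 - l) * tnth z i | i < d] i) ^+ 2 =
    \sum_(i < d) (tnth x i - tnth z i) ^+ 2 - 2 * l * dot_from z x y +
    l ^+ 2 * \sum_(i < d) (tnth y i - tnth z i) ^+ 2.
  rewrite /dot_from !mulr_sumr -sumrB -big_split /=; apply: eq_bigr => i _.
  by rewrite tnth_mktuple; ring.
set S := \sum_(i < d) (tnth y i - tnth z i) ^+ 2 => hh.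
have S0 : 0 <= S by apply: sumr_ge0 => i _; exact: sqr_ge0.
have : 2 * dot_from z x y <= l * S.
  rewrite -(ler_pM2l l0); move: hh; set a := \sum_(i < d) _;
    set b := dot_from _ _ _.
  by lra.
by nra.
Qed.

(** Adding the two inequalities bounds the square of [z1 - z2] by its inner product with [x1 - x2];
    the Cauchy-Schwarz inequality concludes. *)
Lemma nonexpansive_of_obtuse x1 x2 z1 z2 :
  dot_from z1 x1 z2 <= 0 -> dot_from z2 x2 z1 <= 0 ->
    eucdist z1 z2 <= eucdist x1 x2.
Proof.
move=> h1 h2.
pose b := [tuple tnth z1 i - tnth z2 i | i < d].
pose a := [tuple tnth x1 i - tnth x2 i | i < d].
have ab := euclid_dot a b.
have : euclid b ^+ 2 <= \sum_(i < d) tnth a i * tnth b i.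
  rewrite sqr_euclid -subr_ge0.
  have -> : \sum_(i < d) tnth a i * tnth b i - \sum_(i < d) tnth b i ^+ 2 =
      - (dot_from z1 x1 z2 + dot_from z2 x2 z1).
    rewrite /dot_from -sumrB -big_split /= -sumrN; apply: eq_bigr => i _.
    by rewrite !tnth_mktuple; ring.
  by lra.
rewrite /eucdist -/a -/b => h; have := le_trans h ab.
have := euclid_ge0 b; rewrite le0r => /orP[/eqP -> _|b0];
  first exact: euclid_ge0.
by rewrite expr2 ler_pM2r.
Qed.

End obtuse.

(** * The projection of random vectors *)

Section projection.
Context dT (T : measurableType dT) (R : realType) (P : probability T R)
  (d : nat).
Variable G : set (L0vec P d).
Hypotheses (G0 : G !=set0) (sG : sigma_stable G) (bG : as_bounded G).
Hypotheses (cG : closed G) (convG : L0_convex G).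
Implicit Types x y z : L0vec P d.

(* [expR] could be replaced by any strictly monotone function that is bounded
   on the negative reals. *)
Let score x y : \bar R := (\int[P]_w (expR (- eucdist (x w) (y w)))%:E)%E.

Let measurable_score (f : T -> R) : measurable_fun setT f ->
  measurable_fun setT (fun w => (expR (- f w))%:E).
Proof.
move=> mf; apply/measurable_EFinP; apply: measurableT_comp => //.
exact: measurableT_comp.
Qed.

Let measurable_dist x y : measurable_fun setT (fun w => eucdist (x w) (y w)).
Proof. by apply: measurable_eucdist; exact: measurable_repr. Qed.

Let mscore x y :
  measurable_fun setT (fun w => (expR (- eucdist (x w) (y w)))%:E).
Proof. exact: measurable_score (measurable_dist x y). Qed.

Let le_score x y y' :
  {ae P, forall w, eucdist (x w) (y w) <= eucdist (x w) (y' w)} ->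
  (score x y' <= score x y)%E.
Proof.
move=> h; apply: ae_ge0_le_integral => //.
by apply: (ae_mp h); apply: nearW => w hw _; rewrite lee_fin ler_expR lerN2.
Qed.

Let score_le1 x y : (score x y <= 1)%E.
Proof.
apply: (@le_trans _ _ (\int[P]_w (cst 1%E w))%E); last first.
  by rewrite integral_cst// mul1e probability_le1.
apply: ge0_le_integral => //.
by move=> w _; rewrite lee_fin -expR0 ler_expR oppr_le0 eucdist_ge0.
Qed.

Let score_ge0 x y : (0 <= score x y)%E.
Proof. by apply: integral_ge0 => w _; rewrite lee_fin expR_ge0. Qed.

Let score_eq x y y' :
  {ae P, forall w, eucdist (x w) (y w) <= eucdist (x w) (y' w)} ->
  (score x y <= score x y')%E ->
  {ae P, forall w, eucdist (x w) (y w) = eucdist (x w) (y' w)}.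
Proof.
move=> h le.
(* The minimum makes [D] nonnegative everywhere; almost surely [D] is the difference of the two
   integrands. Its integral is zero, so it vanishes almost surely. *)
pose D w := expR (- Num.min (eucdist (x w) (y w)) (eucdist (x w) (y' w))) -
  expR (- eucdist (x w) (y' w)).
have D0 w : 0 <= D w by rewrite subr_ge0 ler_expR lerN2 ge_min lexx orbT.
have mD : measurable_fun setT D.
  apply: measurable_funB; apply/measurable_EFinP/measurable_score => //.
  exact: measurable_minr.
have : (score x y = score x y' + \int[P]_w (D w)%:E)%E.
  have mDE : measurable_fun setT (fun w => (D w)%:E) by exact/measurable_EFinP.
  rewrite -ge0_integralD//; last by move=> w _; rewrite lee_fin.
  apply: ae_eq_integral => //.
  - by apply: emeasurable_funD; [exact: mscore|exact/measurable_EFinP].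
  - apply: (ae_mp h); apply: nearW => w hw _; rewrite -EFinD; congr EFin.
    by rewrite /D (min_idPl hw) addrC subrK.
move=> e; have I0 : (\int[P]_w (D w)%:E = 0)%E.
  apply/eqP; rewrite eq_le integral_ge0 ?andbT//; last by move=> w _;
    rewrite lee_fin.
  have fin : score x y' \is a fin_num.
    by rewrite ge0_fin_numE//; apply: le_lt_trans (score_le1 _ _) _;
      exact: ltry.
  by move: le; rewrite e -[X in (_ <= X)%E]adde0 leeD2lE.
have : (\int[P]_w `|(D w)%:E| = 0)%E.
  by rewrite -I0; apply: eq_integral => w _; rewrite gee0_abs ?lee_fin.
have mDE : measurable_fun setT (EFin \o D) by exact/measurable_EFinP.
move=> /(ae_eq_integral_abs P measurableT mDE) DE.
apply: (ae_mp h); apply: (ae_mp DE); apply: nearW => w /(_ I)[] + hw.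
move=> /eqP; rewrite subr_eq0 => /eqP/expR_inj/oppr_inj <-.
by rewrite (min_idPl hw).
Qed.

(** The limit [z] of a random subsequence of glued minimisers is at least as near to [x] as every
    term of a maximising sequence, hence has the greatest score. Gluing [z] with any [u] of [G], the
    nearer being taken at each sample point, cannot increase the score, so [u] is almost surely no
    nearer than [z]. *)
Lemma nearest_exists x : exists2 z, G z &
  forall y, G y -> {ae P, forall w, eucdist (x w) (z w) <= eucdist (x w) (y w)}.
Proof.
pose S := ereal_sup [set score x y | y in G].
have Sfin : S \is a fin_num.
  rewrite ge0_fin_numE; last first.
    by have [y Gy] := G0; apply: le_trans (score_ge0 x y) _;
      apply: ereal_sup_ubound; exists y.
  apply: (@le_lt_trans _ _ 1%E); last exact: ltry.
  by apply: ge_ereal_sup => _ [y _ <-]; exact: score_le1.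
have /choice[y Hy] : forall n : nat, exists y,
    G y /\ (S - (n.+1%:R^-1)%:E < score x y)%E.
  move=> n; have n0 : 0 < n.+1%:R^-1 :> R by rewrite invr_gt0.
  by have [_ [y Gy <-] yS] := ub_ereal_sup_adherent n0 Sfin; exists y.
have Gy n : G (y n) := (Hy n).1.
pose dy k w := eucdist (x w) (y k w).
(* [v n] is, at each sample point, the nearest to [x] among [y 0], ..., [y n]. *)
have /choice[v Hv] : forall n, exists v : L0vec P d, G v /\
    {ae P, forall w, forall j, (j <= n)%N -> eucdist (x w) (v w) <= dy j w}.
  move=> n; have [|N mN HN] := @measurable_select _ T
    (fun k => \bigcap_(j in [set j | (j <= n)%N]) [set w | dy k w <= dy j w]).
    move=> k; apply: bigcap_measurableType => j _.
    rewrite -[X in measurable X]setTI.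
    by apply: measurable_fun_ler => //; exact: measurable_dist.
  have [v Gv vy] := stable_select sG mN Gy; exists v; split=> //.
  apply: (ae_mp vy); apply: nearW => w vw j jn.
  have [k kmin] : exists k : 'I_n.+1, forall i : 'I_n.+1, dy k w <= dy i w.
    exists [arg min_(i < ord0) dy i w]%O.
    by case: (@arg_minP _ R _ ord0 predT (fun i => dy i w)) => // i _ h l;
      exact: h.
  rewrite vw; apply: (HN w k) => // i /= ni.
  exact: (kmin (Ordinal (ni : (i < n.+1)%N))).
have [z0 [N [mz0 mN HN]]] :=
  @random_subseq _ T R d v (fun n => measurable_repr (v n)).
pose z : L0vec P d := ae_class P mz0.
have [xi _ Gxi] := as_bounded_euclid bG.
have zN : {ae P, forall w, forall k, (k <= N k w)%N /\
    eucdist (v (N k w) w) (z w) < k.+1%:R^-1}.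
  apply: (ae_mp (ae_classE P mz0)).
  have : {ae P, forall w, forall n, euclid (v n w) <= xi w}.
    by apply: ae_foralln => n; exact: Gxi (Hv n).1.
  move=> h; apply: (ae_mp h); apply: nearW => w xiw zw k.
  rewrite /z zw; apply: (HN w (xi w)) => n i.
  exact: le_trans (tnth_le_euclid _ _) (xiw n).
have Gz : G z.
  apply: (@closed_select _ _ _ _ _ _ v) => // [n|]; first exact: (Hv n).1.
  apply: (ae_mp zN); apply: nearW => w h e e0.
  have [k ke] := ltr_add_invr e0; exists (N k w).
  by apply: lt_trans (h k).2 _; rewrite add0r in ke.
have zy j : {ae P, forall w, eucdist (x w) (z w) <= dy j w}.
  have : {ae P, forall w, forall n, forall j,
      (j <= n)%N -> eucdist (x w) (v n w) <= dy j w}.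
    by apply: ae_foralln => n; exact: (Hv n).2.
  move=> h; apply: (ae_mp h); apply: (ae_mp zN); apply: nearW => w zNw vw.
  apply/ler_addgt0Pr => e e0; have [k] := ltr_add_invr e0; rewrite add0r => ke.
  have [kN vz] := zNw (maxn j k).
  apply: le_trans (eucdist_triangle _ (v (N (maxn j k) w) w) _) _.
  apply: lerD; first by apply: vw; rewrite (leq_trans _ kN)// leq_maxl.
  apply/ltW/(lt_trans vz)/le_lt_trans/ke.
  by rewrite lef_pV2 ?posrE// ler_nat ltnS leq_maxr.
have Sz : (S <= score x z)%E.
  rewrite -(fineK Sfin); have := score_ge0 x z; have := score_le1 x z.
  move: (score x z) (fun j => le_score (zy j)) => [s| |]//= ys _ _.
  rewrite lee_fin -subr_le0; apply: (@le0_harmonic _ _ 1) => k.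
  rewrite mul1r lerBlDr -lerBlDl -lee_fin EFinB fineK//.
  exact: le_trans (ltW (Hy k).2) (ys k).
exists z => // u Gu.
(* The selected index is 0 exactly where [u] is strictly nearer than [z]. *)
have [|M mM HM] := @measurable_select _ T
    (fun k => [set w | (k == 0%N) =
      (eucdist (x w) (u w) < eucdist (x w) (z w))]).
  move=> k; rewrite (_ : [set _ | _] =
      (fun w => eucdist (x w) (u w) < eucdist (x w) (z w)) @^-1`
      [set k == 0%N]).
    by rewrite -[X in measurable X]setTI; apply: measurable_fun_ltr.
  by apply/seteqP; split=> w.
have Gpair n : G (if n is 0%N then u else z) by case: n.
have [t Gt tE] := stable_select sG mM Gpair.
have tmin : {ae P, forall w,
    eucdist (x w) (t w) = Num.min (eucdist (x w) (u w)) (eucdist (x w) (z w))}.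
  apply: (ae_mp tE); apply: nearW => w ->; case: ltP => h.
    by have /= := HM w 0%N; rewrite eqxx h => /(_ erefl)/eqP ->.
  have /= := HM w 1%N; rewrite ltNge h => /(_ erefl).
  by case: (M w).
have tz : {ae P, forall w, eucdist (x w) (t w) <= eucdist (x w) (z w)}.
  by apply: (ae_mp tmin); apply: nearW => w ->; rewrite ge_min lexx orbT.
have : (score x t <= score x z)%E.
  by apply: le_trans Sz; apply: ereal_sup_ubound; exists t.
move=> /(score_eq tz) h; apply: (ae_mp h); apply: (ae_mp tmin).
by apply: nearW => w -> <-; rewrite ge_min lexx.
Qed.

(** The convex combinations with the constant coefficients [k.+1%:R^-1] are countably many, so one
    null set serves all the inequalities that [obtuse_of_nearest] requires. *)
Lemma nearest_obtuse x z y : G z -> G y ->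
  (forall y, G y -> {ae P, forall w,
    eucdist (x w) (z w) <= eucdist (x w) (y w)}) ->
  {ae P, forall w, dot_from (z w) (x w) (y w) <= 0}.
Proof.
move=> Gz Gy near.
pose l k : L0 P := L0_cst P k.+1%:R^-1.
have lE k : {ae P, forall w, l k w = k.+1%:R^-1} by exact: ae_classE.
have Gk k : G (l k *: y + (1 - l k) *: z).
  apply: convG => //; apply/L0_leP.
    apply: (ae_mp (lE k)); apply: (ae_mp (L0_0E P)); apply: nearW => w -> ->.
    by rewrite invr_ge0.
  apply: (ae_mp (lE k)); apply: (ae_mp (L0_1E P)); apply: nearW => w -> ->.
  by rewrite invf_le1// ler1n.
have nk : {ae P, forall w, forall k v, (forall i, tnth v i =
    k.+1%:R^-1 * tnth (y w) i + (1 - k.+1%:R^-1) * tnth (z w) i) ->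
    eucdist (x w) (z w) <= eucdist (x w) v}.
  apply: ae_foralln => k; apply: (ae_mp (near _ (Gk k))); apply: (ae_mp (lE k)).
  apply: (ae_mp (L0vec_DE (l k *: y) ((1 - l k) *: z))).
  apply: (ae_mp (L0vec_ZE (l k) y)); apply: (ae_mp (L0vec_ZE (1 - l k) z)).
  apply: (ae_mp (L0_DE 1 (- l k))); apply: (ae_mp (L0_NE (l k))).
  apply: (ae_mp (L0_1E P)); apply: nearW => w e1 eN eB eZ eY eD el h v vE.
  suff -> : v = (l k *: y + (1 - l k) *: z : L0vec P d) w by [].
  by apply: eq_from_tnth => i; rewrite vE eD eZ eY eB eN e1 el.
apply: (ae_mp nk); apply: nearW => w; exact: obtuse_of_nearest.
Qed.

Lemma L0_projection : exists p : L0vec P d -> L0vec P d,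
  [/\ forall x, G (p x), forall x, G x -> p x = x &
   forall x y, {ae P, forall w,
     eucdist (p x w) (p y w) <= eucdist (x w) (y w)}].
Proof.
have /choice[p Hp] : forall x, exists z, G z /\ forall y, G y ->
    {ae P, forall w, eucdist (x w) (z w) <= eucdist (x w) (y w)}.
  by move=> x; have [z] := nearest_exists x; exists z.
exists p; split=> [x|x Gx|x y]; first exact: (Hp x).1.
  apply/ae_class_eqP; apply: (ae_mp ((Hp x).2 x Gx)); apply: nearW => w.
  rewrite eucdistxx => h; apply/esym/eucdist_eq0/eqP.
  by rewrite eq_le h eucdist_ge0.
apply: (ae_mp (nearest_obtuse (Hp x).1 (Hp y).1 (Hp x).2)).
apply: (ae_mp (nearest_obtuse (Hp y).1 (Hp x).1 (Hp y).2)).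
by apply: nearW => w h1 h2; exact: nonexpansive_of_obtuse.
Qed.

End projection.

(** * Fixed points *)

Lemma big_option (V : nmodType) (I : finType) (F : option I -> V) :
  \sum_i F i = F None + \sum_i F (Some i).
Proof.
rewrite (bigD1 None)//=; congr (_ + _).
rewrite (reindex_omap Some id) /=; last by case.
by apply: eq_bigl => i; rewrite eqxx.
Qed.

(** * Approximate fixed points on a simplex *)

Section simplex.
Context (R : realType) (d : nat).
Implicit Types u v : d.-tuple R.

(* A last coordinate makes the sum zero, so that these [d + 1] numbers play the
   role of barycentric coordinates. *)
Definition zcoord u (i : option 'I_d) : R :=
  if i is Some j then tnth u j else - \sum_j tnth u j.

Lemma sum_zcoord u : \sum_i zcoord u i = 0.
Proof. by rewrite big_option addNr. Qed.

(** Both families of coordinates sum to zero, so nonnegative differences all vanish. *)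
Lemma zcoord_le_eq u v : (forall i, zcoord u i <= zcoord v i) -> u = v.
Proof.
move=> uv; have e i : zcoord u i = zcoord v i.
  have : \sum_j (zcoord v j - zcoord u j) = 0.
    by rewrite sumrB !sum_zcoord subrr.
  rewrite (bigD1 i)//= => s0; apply/eqP;
    rewrite eq_le uv /= -subr_le0 -s0 lerDl.
  by apply: sumr_ge0 => j _; rewrite subr_ge0; exact: uv.
by apply: eq_from_tnth => j; exact: (e (Some j)).
Qed.

(** Provides the colour of a grid point: a coordinate that the map does not decrease. *)
Lemma zcoord_ge u v : exists i, zcoord u i <= zcoord v i.
Proof.
have [//|nuv] := pselect (exists i, zcoord u i <= zcoord v i).
have vu i : zcoord v i < zcoord u i by rewrite ltNge; apply/negP => h;
  apply: nuv; exists i.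
have uv : v = u by apply: zcoord_le_eq => i; exact: ltW.
by have := vu None; rewrite uv ltxx.
Qed.

Lemma zcoord_dist u v i : `|zcoord u i - zcoord v i| <= d.+1%:R * eucdist u v.
Proof.
have d0 := eucdist_ge0 u v; case: i => [j|] /=.
  apply: le_trans (tnth_le_eucdist u v j) _.
  by rewrite ler_peMl// ler1n.
rewrite -opprD normrN -sumrB; apply: le_trans (ler_norm_sum _ _ _) _.
apply: (@le_trans _ _ (\sum_(i < d) eucdist u v)).
  by apply: ler_sum => j _; exact: tnth_le_eucdist.
by rewrite sumr_const card_ord -[eucdist u v *+ d]mulr_natl ler_wpM2r// ler_nat.
Qed.

Lemma zcoord_ge_bound v M i : 0 <= M -> (forall j, `|tnth v j| <= M) ->
  - (if i is Some _ then M else d%:R * M) <= zcoord v i.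
Proof.
move=> M0 vM; case: i => [j|] /=; first by have := vM j;
  rewrite ler_norml => /andP[].
rewrite lerN2; apply: (@le_trans _ _ (\sum_(i < d) M)).
  by apply: ler_sum => j _; apply: le_trans (ler_norm _) (vM j).
by rewrite sumr_const card_ord -[M *+ d]mulr_natl.
Qed.

Local Notation grid := {ffun option 'I_d -> nat}.

(** For [v] of total [n.+1], the point with barycentric coordinates [v / n.+1] in the simplex of the
    points whose coordinates are at least -1 and sum to at most [d]. This simplex contains the cube
    $[-1,1]^d$. *)
Definition grid_coord (n : nat) (v : grid) (j : 'I_d) : R :=
  2 * d%:R * (v (Some j))%:R / n.+1%:R - 1.

Definition mesh (n : nat) : R := 2 * d%:R * d.+1%:R / n.+1%:R.

(** The values of [K] lie in a cube inside the simplex. A point [y i] of colour [i] does not lose in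
    coordinate [i]; otherwise it lies within the mesh of the face where this coordinate is least,
    and no value of [K] is beyond this face. *)
Lemma scarf_points (n : nat) (M : R) (H K : grid -> d.-tuple R) :
  (0 < d)%N -> 0 <= M ->
  (forall (v : grid) j, tnth (H v) j = M * grid_coord n v j) ->
  (forall (v : grid) j, `|tnth (K v) j| <= M) ->
  exists y : option 'I_d -> grid,
  [/\ forall i k, `|tnth (H (y i)) k| <= M * (2 * d%:R),
   forall i j k, `|tnth (H (y i)) k - tnth (H (y j)) k| <= M * mesh n &
   forall i, zcoord (H (y i)) i <= zcoord (K (y i)) i + M * mesh n].
Proof.
move=> d0 M0 HE KM.
have /choice[c Hc] : forall v : option 'I_d -> nat, exists i,
    zcoord (H (finfun v)) i <= zcoord (K (finfun v)) i by move=> v;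
      exact: zcoord_ge.
have cardI : #|{: option 'I_d}| = d.+1 by rewrite card_option card_ord.
have I_gt1 : (1 < #|{: option 'I_d}|)%N by rewrite cardI ltnS.
have [y [ysum yclose ycol]] := scarf_grid n.+1 c I_gt1.
have n0 : 0 < n.+1%:R :> R by rewrite ltr0n.
have dR : 1 <= d%:R :> R by rewrite ler1n.
have mesh0 : 0 <= M * mesh n by rewrite !mulr_ge0// invr_ge0.
exists (fun i => finfun (y i)); split.
- move=> i k; rewrite HE /grid_coord ffunE normrM (ger0_norm M0) ler_wpM2l//.
  have : (y i (Some k))%:R / n.+1%:R <= 1 :> R.
    rewrite ler_pdivrMr// mul1r ler_nat -(ysum i) (bigD1 (Some k))//=.
    exact: leq_addr.
  have : 0 <= (y i (Some k))%:R / n.+1%:R :> R by rewrite divr_ge0.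
  rewrite -mulrA; set t := _ / _ => t0 t1.
  by rewrite ler_norml; apply/andP; split; nra.
- move=> i j k; rewrite !HE /grid_coord !ffunE -mulrBr normrM (ger0_norm M0).
  rewrite ler_wpM2l// /mesh [X in `|X|](_ : _ = 2 * d%:R *
    ((y i (Some k))%:R - (y j (Some k))%:R) / n.+1%:R); last by field;
      rewrite lt0r_neq0.
  rewrite !normrM normfV (gtr0_norm n0) ler_pM2r ?invr_gt0//.
  rewrite !normr_nat -!mulrA ler_pM2l// ler_wpM2l//.
  have := yclose i j (Some k); have := yclose j i (Some k); rewrite cardI.
  rewrite -!(ler_nat R) !natrD => h1 h2.
  by rewrite ler_norml; apply/andP; split; lra.
- move=> i; have [ci|yi] := ycol i.
    have := Hc (y i); rewrite ci => h; apply: le_trans h _.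
    by rewrite lerDl.
  have lo := zcoord_ge_bound i M0 (KM (finfun (y i))).
  rewrite cardI in yi.
  have hi : M * (2 * d%:R * (y i i)%:R / n.+1%:R) <= M * mesh n.
    rewrite ler_wpM2l// ler_pM2r ?invr_gt0// ler_wpM2l ?mulr_ge0//.
    by rewrite ler_nat.
  (* Each [zcoord] is affine in the corresponding barycentric coordinate, also for [None] since the
     grid coordinates sum to [n.+1]. *)
  suff -> : zcoord (H (finfun (y i))) i =
    M * (2 * d%:R * (y i i)%:R / n.+1%:R) +
      - (if i is Some _ then M else d%:R * M) by rewrite addrC; exact: lerD.
  case: i {yi lo hi} => [j|] /=.
    by rewrite HE /grid_coord ffunE; ring.
  have s : \sum_j (y None (Some j))%:R = n.+1%:R - (y None None)%:R :> R.
    by rewrite -(ysum None) big_option natrD addrC addKr natr_sum.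
  under eq_bigr do rewrite HE /grid_coord ffunE.
  have -> : \sum_(j < d) M * (2 * d%:R * (y None (Some j))%:R / n.+1%:R - 1) =
      M * (2 * d%:R * (\sum_j (y None (Some j))%:R) / n.+1%:R - d%:R).
    rewrite -mulr_sumr sumrB sumr_const card_ord; congr (M * (_ - _)).
    by rewrite mulr_sumr mulr_suml.
  by rewrite s; field; rewrite lt0r_neq0.
Qed.

End simplex.

Lemma ae_forall_count dT (T : measurableType dT) (R : realType)
    (mu : {measure set T -> \bar R}) (I : countType) (Q : I -> T -> Prop) :
  (forall i, {ae mu, forall w, Q i w}) -> {ae mu, forall w, forall i, Q i w}.
Proof.
move=> h; suff hk : {ae mu, forall w, forall k,
  if unpickle k is Some i then Q i w else True}.
  by apply: (ae_mp hk); apply: nearW => w hw i; have := hw (pickle i);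
    rewrite pickleK.
by apply: ae_foralln => k; case: unpickle => [i|]; [exact: h|exact: nearW].
Qed.

Section L0_brouwer.
Context dT (T : measurableType dT) (R : realType) (P : probability T R)
  (d : nat).
Hypothesis d_gt0 : (0 < d)%N.
Variables (g : L0vec P d -> L0vec P d) (xi : L0 P).
Hypothesis xi_ge0 : {ae P, forall w, 0 <= xi w}.
Hypothesis g_bounded : forall x, {ae P, forall w, euclid (g x w) <= xi w}.
Hypothesis g_local : forall (N : T -> nat)
    (x : nat -> L0vec P d) (z : L0vec P d),
  measurable_fun setT N -> {ae P, forall w, z w = x (N w) w} ->
  {ae P, forall w, g z w = g (x (N w)) w}.
Hypothesis g_continuous : forall x (e : L0 P), L0_pp e ->
  exists2 r, L0_pp r & forall y, L0_ball x r y -> L0_ball (g x) e (g y).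

Local Notation I := (option 'I_d).
Local Notation grid := {ffun I -> nat}.

Let measurable_grid_point (n : nat) (v : grid) :
  measurable_fun setT (fun w => [tuple xi w * grid_coord R n v j | j < d]).
Proof.
by apply: measurable_mktuple => j; apply: measurable_funM.
Qed.

Let point n v : L0vec P d := ae_class P (measurable_grid_point n v).

(* A natural number encodes a grid size together with a family of grid points
   indexed by the colours. *)
Let vertex (i : I) (c : nat) : L0vec P d :=
  if unpickle c is Some (n, t) then point n ((t : {ffun I -> grid}) i) else 0.

Let near_vertices (e : R) (c : nat) (w : T) :=
  (forall i j k, `|tnth (vertex i c w) k - tnth (vertex j c w) k| <= e) /\
  (forall i, zcoord (vertex i c w) i <= zcoord (g (vertex i c) w) i + e).

Let measurable_zcoord (u : T -> d.-tuple R) i :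
  measurable_fun setT u -> measurable_fun setT (fun w => zcoord (u w) i).
Proof.
move=> /measurable_fun_tnthP mu; case: i => [j|]; first exact: mu.
apply: measurableT_comp => //; apply: measurable_sum => j; exact: mu.
Qed.

Let measurable_near (e : T -> R) c : measurable_fun setT e ->
  measurable [set w | near_vertices (e w) c w].
Proof.
move=> me; have mv i k : measurable_fun setT (fun w => tnth (vertex i c w) k).
  exact: measurable_tnth_repr.
rewrite (_ : [set _ | _] =
    (\bigcap_(i in [set: I]) \bigcap_(j in [set: I]) \bigcap_(k in [set: 'I_d])
      [set w | `|tnth (vertex i c w) k - tnth (vertex j c w) k| <= e w]) `&`
    (\bigcap_(i in [set: I])
      [set w | zcoord (vertex i c w) i <=
        zcoord (g (vertex i c) w) i + e w])); last first.
  apply/seteqP; split=> [w [h1 h2]|w [h1 h2]].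
    by split=> [i _ j _ k _|i _]; [exact: h1|exact: h2].
  by split=> [i j k|i]; [exact: h1|exact: h2].
apply: measurableI.
  do 3 (apply: fin_bigcap_measurable => // ? _).
  rewrite -[X in measurable X]setTI; apply: measurable_fun_ler => //.
  by apply: measurableT_comp => //; apply: measurable_funB.
apply: fin_bigcap_measurable => // i _.
rewrite -[X in measurable X]setTI; apply: measurable_fun_ler => //.
  exact: measurable_zcoord.
apply: measurable_funD => //; apply: measurable_zcoord; exact: measurable_repr.
Qed.

(** [scarf_points] is applied at each sample point. There are countably many grid points, so one
    null set covers the bounds on the values of [g] at all of them. *)
Let exists_near_vertices : {ae P, forall w, forall n, exists c,
  near_vertices (xi w * mesh R d n) c w /\
  forall k, `|tnth (vertex None c w) k| <= xi w * (2 * d%:R)}.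
Proof.
have pE : {ae P, forall w, forall (n : nat) (v : grid) j,
    tnth (point n v w) j = xi w * grid_coord R n v j}.
  apply: ae_foralln => n; apply: ae_forall_count => v.
  apply: (ae_mp (ae_classE P (measurable_grid_point n v))); apply: nearW => w.
  by rewrite /point => -> j; rewrite tnth_mktuple.
have gE : {ae P, forall w, forall (n : nat) (v : grid),
  euclid (g (point n v) w) <= xi w}.
  by apply: ae_foralln => n; apply: ae_forall_count => v; exact: g_bounded.
apply: (ae_mp pE); apply: (ae_mp gE); apply: (ae_mp xi_ge0).
apply: nearW => w xi0 gw pw n.
have [|y [yb yc yg]] := scarf_points d_gt0 xi0 (pw n)
    (K := fun v => g (point n v) w).
  by move=> v j; apply: le_trans (tnth_le_euclid _ _) (gw n v).
pose c := pickle (n, [ffun i => y i] : {ffun I -> grid}).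
have vE i : vertex i c = point n (y i) by rewrite /vertex pickleK ffunE.
exists c; split; last by move=> k; rewrite vE; exact: yb.
by split=> [i j k|i]; rewrite !vE; [exact: yc|exact: yg].
Qed.

Lemma L0_brouwer : exists z, g z = z.
Proof.
pose goodb n (c : nat) w := near_vertices (xi w * mesh R d n) c w /\
  forall k, `|tnth (vertex None c w) k| <= xi w * (2 * d%:R).
have mgood n c : measurable [set w | goodb n c w].
  rewrite (_ : [set _ | _] = [set w | near_vertices (xi w * mesh R d n) c w] `&`
    \bigcap_(k in [set: 'I_d])
      [set w | `|tnth (vertex None c w) k| <= xi w * (2 * d%:R)]); last first.
    apply/seteqP; split=> [w [h1 h2]|w [h1 h2]]; split=> // k.
      by move=> _; exact: h2.
    exact: h2.
  have mxi : measurable_fun setT xi by exact: measurable_repr.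
  apply: measurableI.
    by apply: measurable_near; apply: measurable_funM.
  apply: fin_bigcap_measurable => // k _.
  rewrite -[X in measurable X]setTI; apply: measurable_fun_ler => //.
    by apply: measurableT_comp => //; exact: measurable_tnth_repr.
  exact: measurable_funM.
have /choice[C HC] : forall n, exists Cn : T -> nat, measurable_fun setT Cn /\
    forall w c, goodb n c w -> goodb n (Cn w) w.
  by move=> n; have [Cn] := measurable_select (mgood n); exists Cn.
have Cgood : {ae P, forall w, forall n, goodb n (C n w) w}.
  apply: (ae_mp exists_near_vertices); apply: nearW => w ex n.
  by have [c] := ex n; exact: (HC n).2.
(* It suffices to follow the vertex of colour [None]: the others are within the mesh of it. *)
have [|z0 [N [mz0 mN HN]]] := @random_subseq _ T R d
    (fun n w => vertex None (C n w) w).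
  by move=> n; apply:
    (measurable_fun_index (F := fun c w => vertex None c w)) (HC n).1 _.
pose z : L0vec P d := ae_class P mz0.
pose c k w := C (N k w) w.
have mc k : measurable_fun setT (c k).
  by apply: (measurable_fun_index (F := C)) => // n; exact: (HC n).1.
have cvg : {ae P, forall w, forall k, (k <= N k w)%N /\
    eucdist (vertex None (c k w) w) (z w) < k.+1%:R^-1}.
  apply: (ae_mp (ae_classE P mz0)); apply: (ae_mp Cgood);
    apply: nearW => w Cw zw k.
  by rewrite /z zw; apply: (HN w (xi w * (2 * d%:R))) => n i; exact: (Cw n).2.
have zcoord_close : {ae P, forall w, forall i m,
    zcoord (z w) i - zcoord (g z w) i <= (d.+1%:R * 2 + 1) * m.+1%:R^-1}.
  suff h m : {ae P, forall w, forall i,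
      zcoord (z w) i - zcoord (g z w) i <= (d.+1%:R * 2 + 1) * m.+1%:R^-1}.
    by apply: (ae_mp (ae_foralln h)); apply: nearW => w + i m; exact.
  set e : R := m.+1%:R^-1; have e_gt0 : 0 < e by rewrite invr_gt0.
  have eE : {ae P, forall w, L0_cst P e w = e} by exact: ae_classE.
  have e_pp : L0_pp (L0_cst P e).
    by apply: (ae_mp eE); apply: (ae_mp (L0_0E P)); apply: nearW => w -> ->.
  have [r r_gt0 gr] := g_continuous z e_pp.
  (* The radius [r] is random, so the index at which all vertices are close enough to [z] has to be
     random as well. *)
  pose Q k w := near_vertices e (c k w) w /\
    forall i, eucdist (vertex i (c k w) w) (z w) < Num.min e (r w).
  have mr : measurable_fun setT r by exact: measurable_repr.
  have [|K mK HK] := @measurable_select _ T (fun k => [set w | Q k w]).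
    move=> k; have -> : [set w | Q k w] = \bigcup_b ([set w | c k w = b] `&`
        ([set w | near_vertices e b w] `&` \bigcap_(i in [set: I])
          [set w | eucdist (vertex i b w) (z w) < Num.min e (r w)])).
      apply/seteqP; split=> [w [h1 h2]|w [b _ [/= <- [h1 h2]]]].
        by exists (c k w) => //; split=> //; split=> // i _; exact: h2.
      by split=> // i; exact: h2.
    apply: bigcup_measurable => b _; apply: measurableI.
      by rewrite -[X in measurable X]setTI; exact: (mc k measurableT [set b]).
    apply: measurableI; first exact: measurable_near.
    apply: fin_bigcap_measurable => // i _.
    rewrite -[X in measurable X]setTI; apply: measurable_fun_ltr => //.
      by apply: measurable_eucdist => //; exact: measurable_repr.
    exact: measurable_minr.
  have exQ : {ae P, forall w, exists k, Q k w}.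
    apply: (ae_mp Cgood); apply: (ae_mp cvg); apply: (ae_mp xi_ge0).
    apply: (ae_mp r_gt0); apply: (ae_mp (L0_0E P)).
    apply: nearW => w -> rw xi0 cw Cw.
    have er0 : 0 < Num.min e (r w) by rewrite lt_min e_gt0.
    (* With [N k w >= k], the scaled mesh is at most [B / k.+1], and [D / k.+1] bounds both this and
       the distance of every vertex to [z], obtained from [d] coordinate gaps and the error of the
       vertex [None]. *)
    pose B := xi w * (2 * d%:R * d.+1%:R); pose D := d%:R * B + B + 1.
    have B0 : 0 <= B by rewrite !mulr_ge0.
    have D0 : 0 < D by rewrite ltr_wpDl// addr_ge0// mulr_ge0.
    have [k] := @ltr_add_invr R 0 (Num.min e (r w) / D) (divr_gt0 er0 D0).
    rewrite add0r ltr_pdivlMr// => kD; exists k.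
    have [kN vz] := cw k; have [[nv ng] _] := Cw (N k w).
    have small : xi w * mesh R d (N k w) <= B * k.+1%:R^-1.
      by rewrite /mesh mulrA ler_wpM2l// lef_pV2 ?posrE// ler_nat ltnS.
    have k0 : 0 < k.+1%:R^-1 :> R by rewrite invr_gt0.
    have dB0 : 0 <= d%:R * B by rewrite mulr_ge0.
    have B_lt : B * k.+1%:R^-1 < Num.min e (r w).
      by apply: le_lt_trans kD; rewrite mulrC ler_pM2l// /D; lra.
    have Be : xi w * mesh R d (N k w) <= e.
      by apply: le_trans small _; apply: ltW; move: B_lt;
        rewrite lt_min => /andP[].
    split; first split.
    - by move=> i j l; exact: le_trans (nv i j l) Be.
    - by move=> i; apply: le_trans (ng i) _; rewrite lerD2l.
    - move=> i; apply: le_lt_trans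
        (eucdist_triangle _ (vertex None (c k w) w) _) _.
      apply: le_lt_trans kD; apply:
        (@le_trans _ _ (d%:R * (B * k.+1%:R^-1) + k.+1%:R^-1)).
        apply: lerD; last exact: ltW.
        apply: le_trans (eucdist_le_sum _ _) _.
        apply: (@le_trans _ _ (\sum_(l < d) B * k.+1%:R^-1)).
          by apply: ler_sum => l _; exact: le_trans (nv i None l) small.
        by rewrite sumr_const card_ord -[_ *+ d]mulr_natl.
      rewrite mulrA -{2}[_^-1]mul1r -mulrDl mulrC ler_pM2l// /D; lra.
  pose cK w := c (K w) w.
  have mcK : measurable_fun setT cK by exact: measurable_fun_index.
  (* Continuity at [z] concerns elements of the module, hence the vertices at the random code are
     glued into [y i]. By [g_local], [g (y i)] takes the values of [g] at vertices of fixed code,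
     for which the bounds of [near_vertices] hold. *)
  have /choice[y Hy] : forall i, exists y : L0vec P d,
      {ae P, forall w, y w = vertex i (cK w) w}.
    move=> i; have [A AN] := index_partition mcK.
    by exists (concat A (vertex i)); exact: concat_index.
  have KQ : {ae P, forall w, Q (K w) w}.
    by apply: (ae_mp exQ); apply: nearW => w [k]; exact: HK.
  have gy i : {ae P, forall w,
    eucdist (g z w) (g (vertex i (cK w)) w) < e /\ Q (K w) w}.
    have zy : L0_ball z r (y i).
      apply/L0_ballE; apply: (ae_mp KQ); apply: (ae_mp (Hy i)).
      apply: nearW => w -> [_ /(_ i)]; rewrite lt_min => /andP[_].
      by rewrite eucdistC.
    have /L0_ballE b := gr _ zy.
    apply: (ae_mp b); apply: (ae_mp eE); apply: (ae_mp (g_local mcK (Hy i))).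
    by apply: (ae_mp KQ); apply: nearW => w Qw -> ->.
  (* The constant counts two distances below [e], from [z] to the vertex and between their images,
     each multiplied by the Lipschitz constant [d.+1%:R] of [zcoord], and the defect [e] of
     [near_vertices]. *)
  have step i : {ae P, forall w,
      zcoord (z w) i - zcoord (g z w) i <= (d.+1%:R * 2 + 1) * e}.
    apply: (ae_mp (gy i)); apply: nearW => w [ge [[_ /(_ i) vg] /(_ i)]].
    rewrite lt_min => /andP[ve _].
    have := zcoord_dist (vertex i (cK w) w) (z w) i.
    have := zcoord_dist (g z w) (g (vertex i (cK w)) w) i.
    rewrite !ler_norml => /andP[h1 h1'] /andP[h2 h2'].
    have d0 : 0 <= d.+1%:R :> R by [].
    have h3 : d.+1%:R * eucdist (g z w) (g (vertex i (cK w)) w) <= d.+1%:R * e.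
      by rewrite ler_wpM2l// ltW.
    have h4 : d.+1%:R * eucdist (vertex i (cK w) w) (z w) <= d.+1%:R * e.
      by rewrite ler_wpM2l// ltW.
    by rewrite -/(cK w) in vg; lra.
  exact: ae_forall_count.
exists z; apply/ae_class_eqP; apply: (ae_mp zcoord_close); apply: nearW => w h.
apply/esym/zcoord_le_eq => i; rewrite -subr_le0; exact: le0_harmonic (h i).
Qed.

End L0_brouwer.

Theorem theorem2p1 (R : realType) (disp : measure_display)
    (Omega : measurableType disp) (P : probability Omega R)
    (d : nat) (d_gt0 : (0 < d)%N)
    (G : set (L0vec P d)) (G_nonempty : G !=set0)
    (G_stable : sigma_stable G) (G_bounded : as_bounded G)
    (G_closed : closed G) (G_convex : L0_convex G)
    (f : {fun G >-> G}) (f_stable : sigma_stable_map G f)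
    (f_continuous : {within G, continuous f}) :
  exists2 x : L0vec P d, G x & f x = x.
Proof.
have [p [Gp pG p_dist]] :=
  L0_projection G_nonempty G_stable G_bounded G_closed G_convex.
have [xi xi_ge0 Gxi] := as_bounded_euclid G_bounded.
have Gf x : G x -> G (f x) by move=> Gx; exact: funS.
have [|||x fpx] := @L0_brouwer _ _ _ P d d_gt0 (f \o p) xi xi_ge0.
- by move=> x; apply/Gxi/Gf.
- move=> N x z mN zx.
  apply: (stable_map_select f_stable mN (x := p \o x)) => // [n|];
    first exact: Gp.
  (* Nonexpansiveness makes [p] local: where [z] agrees with [x n], the distance between [p z] and
     [p (x n)] is zero. *)
  apply: (ae_mp (ae_foralln (fun n => p_dist z (x n)))); apply: (ae_mp zx).
  apply: nearW => w zxw h; apply/eucdist_eq0/eqP;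
    rewrite eq_le eucdist_ge0 andbT.
  by apply: le_trans (h (N w)) _; rewrite zxw eucdistxx.
- move=> x e e0.
  have [r r0 fr] := within_continuous_ball f_continuous (Gp x) e0.
  exists r => // y /L0_ballE xy; apply: fr; first exact: Gp.
  apply/L0_ballE; apply: (ae_mp (p_dist x y)); apply: (ae_mp xy).
  by apply: nearW => w xyw pxy; exact: le_lt_trans xyw.
(* The fixed point of [f \o p] is a value of [f], so it lies in [G], where [p] is the identity. *)
have Gx : G x by rewrite -fpx; exact/Gf/Gp.
by exists x; rewrite // -{1}(pG x Gx).
Qed.
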